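(* Let $G$ be a finite simple graph with minimum degree $\delta(G)\ge 2$. (a) If $6\|G[A]\|\le 7|A|+2$ for every nonempty $A\subseteq V(G)$, then $G$ is SE $3$-choosable. (b) If $4\|G[A]\|\le 5|A|+2$ for every nonempty $A\subseteq V(G)$, then $G$ is SE $4$-choosable.
   Context: For a graph $G$ and $A\subseteq V(G)$, $\|G[A]\|$ denotes the number of edges of the subgraph induced by $A$, and $|A|$ the number of vertices. A $k$-list assignment $L$ for $G$ assigns to each vertex $v$ a set $L(v)$ of exactly $k$ colors; an $L$-coloring is a proper vertex coloring $f$ with $f(v)\in L(v)$ for all $v$. For an integer $n$ and $k\ge1$, $n\bmod^* k$ is the unique $m\in\{1,\dots,k\}$ with $n\equiv m\pmod k$. If $|V(G)|=n\ge 1$, an $L$-coloring $f$ of $G$ is strongly equitable (SE) if every color class has at most $\lceil n/k\rceil$ vertices and the number of colors whose class has exactly $\lceil n/k\rceil$ vertices (the full classes) is at most $n\bmod^* k$; the empty graph is regarded as SE $L$-colorable. $G$ is SE $k$-choosable if it has an SE $L$-coloring for every $k$-list assignment $L$. *)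

(* Defs.v *)
From mathcomp Require Import all_boot.
Set Implicit Arguments. Unset Strict Implicit. Unset Printing Implicit Defensive.

Definition simple_graph (T : finType) (e : rel T) : Prop :=
  symmetric e /\ irreflexive e.

Definition deg (T : finType) (e : rel T) (v : T) : nat := #|[set u | e v u]|.

Definition induced_edges (T : finType) (e : rel T) (A : {set T}) : nat :=
  #|[set E : {set T} | [exists x in A, exists y in A, e x y && (E == [set x; y])]]|.

Definition list_assignment (T : finType) (k : nat) (L : T -> seq nat) : Prop :=
  forall v, uniq (L v) /\ size (L v) = k.

Definition L_coloring (T : finType) (e : rel T) (L : T -> seq nat)
  (f : T -> nat) : Prop :=
  (forall v, f v \in L v) /\ (forall u v, e u v -> f u != f v).

Definition color_class (T : finType) (f : T -> nat) (c : nat) : {set T} :=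
  [set v | f v == c].

Definition ceil_div (n k : nat) : nat := (n + k - 1) %/ k.

(* n mod* k : the unique m in {1..k} with n = m mod k (for k >= 1) *)
Definition modstar (n k : nat) : nat := ((n + k - 1) %% k).+1.

(* strongly equitable coloring (the empty graph is SE by convention) *)
Definition SE_coloring (T : finType) (k : nat) (f : T -> nat) : Prop :=
  let n := #|T| in
  (0 < n) ->
  (forall c, #|color_class f c| <= ceil_div n k) /\
  count (fun c => #|color_class f c| == ceil_div n k)
        (undup [seq f v | v <- enum T])
    <= modstar n k.

Definition SE_choosable (T : finType) (e : rel T) (k : nat) : Prop :=
  forall L : T -> seq nat, list_assignment k L ->
  exists f : T -> nat, L_coloring e L f /\ SE_coloring k f.

(* Main.v *)
Require Import Defs.
From mathcomp Require Import all_boot zify.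
From Stdlib Require Import Classical.
Set Implicit Arguments. Unset Strict Implicit. Unset Printing Implicit Defensive.

(* For a vertex set V let W(V) be the sum of (d(v) - 2)^+ over V plus the number of cycle
   components of G[V]; W does not increase when vertices are deleted. Sparsity gives an
   upper bound on W(V(G)), and every list coloring is built backwards: one deletes k
   vertices (or, once, n mod* k of them) that can be colored greedily with distinct
   colors once the rest is colored, while W drops by 1 (k = 3) or 2 (k = 4). If no such
   deletion existed, then the vertices of degree at most 2 could be discharged to the
   vertices of higher degree (the hubs), and counting would contradict the bound on W. *)

(** Minimum degree 2 is lost as soon as vertices are deleted, so the induction cannot carry the
    hypotheses of the theorem; it carries 2-degeneracy and a bound on W. At the start, minimum
    degree 2 makes the excess of a union A of components equal to 2(||G[A]|| - |A|), whence 3W <= n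
    + 2 in (a) and 2W <= n + 2 in (b). Cycle components are counted in W because a neighbour whose
    degree falls from 3 to 2 may close one. The lost unit of excess then brings no progress, since
    such a component has no hub to receive its charge. A vertex preceded by j others in a deleted
    list may keep at most k - 1 - j neighbours outside the list, so the last of k vertices must lose
    all of them. This dictates the reducible configurations: vertices of degree at most 2 (called
    low below) that are deleted together with their neighbours. *)

Lemma exists_notin (s t : seq nat) :
  uniq s -> size t < size s -> exists2 c, c \in s & c \notin t.
Proof.
move=> us lt_ts; apply/hasP; apply/negPn/negP => /hasPn st.
suff: size s <= size t by rewrite leqNgt lt_ts.
by apply: uniq_leq_size => // c /st; rewrite negbK.
Qed.

Lemma uniq_map_in_inj (A B : eqType) (f : A -> B) s :
  uniq (map f s) -> {in s &, injective f}.
Proof.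
elim: s => // a s IH /= /andP[fa us] x y.
rewrite !inE => /orP[/eqP->|xs] /orP[/eqP->|ys] // E; last exact: IH.
  by rewrite E map_f in fa.
by rewrite -E map_f in fa.
Qed.

Lemma division_unique k a b x y : 0 < x <= k -> 0 < y <= k ->
  k * a + x = k * b + y -> a = b /\ x = y.
Proof.
move=> hx hy E; case: (ltngtP a b) => ab; last by lia.
  have := leq_mul (leqnn k) ab; rewrite mulnS; lia.
have := leq_mul (leqnn k) ab; rewrite mulnS; lia.
Qed.

(** * Greedy extension of strongly equitable colorings *)

Section Graph.
Variables (T : finType) (e : rel T).

Definition nb (U : {set T}) x := [set y in U | e x y].
Definition dg U x := #|nb U x|.

(** Colors are chosen from the head on: the vertex at position [j] avoids [j] earlier colors and
    those of its neighbours in [W]. Vertices that lose most neighbours therefore go last. *)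
Fixpoint slots (W : {set T}) k i (s : seq T) :=
  if s is x :: s' then (dg W x + i < k) && slots W k i.+1 s' else true.

Definition cls (f : T -> nat) (U : {set T}) c := [set v in U | f v == c].

(** Here [q.+1] is the ceiling of |U|/k and [m] is |U| mod* k. Since [m] is positive, the condition
    is void for empty [U]. *)
Definition SE_on k (f : T -> nat) (U : {set T}) :=
  forall q m, 0 < m <= k -> #|U| = k * q + m ->
  (forall c, #|cls f U c| <= q.+1) /\
  (forall t, uniq t -> (forall c, c \in t -> #|cls f U c| = q.+1) -> size t <= m).

Definition colorable k (L : T -> seq nat) (U : {set T}) :=
  exists f, [/\ {in U, forall v, f v \in L v},
    {in U &, forall u v, e u v -> f u != f v} & SE_on k f U].

Definition del (V : {set T}) (s : seq T) := V :\: [set x in s].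

(** [used] holds the colors given to earlier vertices of the list. All colors on [s] come out
    distinct, which also settles the edges inside [s]. *)
Lemma greedy_extension k L (W : {set T}) s i f used :
  list_assignment k L -> uniq s -> {in s, forall x, x \notin W} ->
  size used <= i -> slots W k i s ->
  exists g, [/\ {in [predC s], g =1 f}, {in s, forall x, g x \in L x},
    {in s & W, forall x y, e x y -> g x != g y},
    {in s, forall x, g x \notin used} & uniq (map g s)].
Proof.
move=> kL; elim: s i f used => [|x s IH] i f used; first by exists f.
move=> /= /andP[xs us] sW su /andP[dx sl].
have [uL sL] := kL x.
have xW : x \notin W by apply: sW; rewrite mem_head.
have [|c cL] := @exists_notin (L x) (used ++ [seq f y | y <- enum (nb W x)]) uL.
  by rewrite size_cat size_map -cardE sL -/(dg W x); lia.
rewrite mem_cat => /norP[cu cf].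
have [||||g [gf gL gW gu ug]] := IH i.+1 (fun z => if z == x then c else f z) (c :: used) => //.
  by move=> y ys; apply: sW; rewrite inE ys orbT.
have gx : g x = c by rewrite gf ?eqxx.
have gfs z : z != x -> z \notin s -> g z = f z by move=> zx zs; rewrite gf // (negPf zx).
exists g; split.
- by move=> z; rewrite !inE => /norP[zx zs]; apply: gfs.
- by move=> z; rewrite inE => /orP[/eqP->|/gL //]; rewrite gx.
- move=> z y; rewrite inE => /orP[/eqP->|zs] yW; last exact: gW.
  move=> xy; apply: contraNneq cf => gxy; rewrite -gx gxy.
  have yx : y != x by apply: contraNneq xW => <-.
  have ys : y \notin s by apply: contraTN yW => ys; apply: sW; rewrite inE ys orbT.
  by rewrite gfs //; apply: map_f; rewrite mem_enum inE yW.
- by move=> z; rewrite inE => /orP[/eqP->|/gu]; [rewrite gx | rewrite inE => /norP[]].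
- rewrite /= ug andbT gx; apply/mapP=> -[z zs cz].
  by have := gu _ zs; rewrite -cz mem_head.
Qed.

Hypothesis sym : symmetric e.
Hypothesis irr : irreflexive e.

Lemma card_cls_del (f : T -> nat) V s c : uniq (map f s) ->
  #|cls f V c| <= #|cls f (del V s) c| + (c \in map f s).
Proof.
move=> ufs; have -> : cls f V c = cls f (del V s) c :|: cls f (V :&: [set x in s]) c.
  by apply/setP => v; rewrite !inE; case: (v \in s); rewrite ?andbT ?andbF ?orbF.
apply: leq_trans (leq_card_setU _ _) _; rewrite leq_add2l.
case: (boolP (c \in _)) => [/mapP[x xs cx]|cs].
  rewrite (leq_trans (subset_leq_card (_ : _ \subset [set x]))) ?cards1 //.
  apply/subsetP => v; rewrite !inE => /andP[/andP[_ vs] /eqP fv].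
  by apply/eqP; apply: (uniq_map_in_inj ufs) => //; rewrite fv.
rewrite leqn0 cards_eq0; apply/eqP/setP => v; rewrite !inE.
by apply: contraNF cs => /andP[/andP[_ vs] /eqP<-]; apply: map_f.
Qed.

Lemma mem_del V s x : (x \in del V s) = (x \notin s) && (x \in V).
Proof. by rewrite !inE. Qed.

Lemma card_del (V : {set T}) s : uniq s -> {subset s <= V} -> #|V| = #|del V s| + size s.
Proof.
move=> us sV; have -> : size s = #|[set x in s]| by rewrite cardsE; apply/esym/card_uniqP.
rewrite /del addnC cardsDS ?subnKC ?subset_leq_card //; apply/subsetP => x;
  rewrite inE; exact: sV.
Qed.

Lemma cls_sub_map (f : T -> nat) (V : {set T}) s c : #|V| = size s -> uniq s -> {subset s <= V} ->
  0 < #|cls f V c| -> c \in map f s.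
Proof.
move=> cV us sV; rewrite card_gt0 => /set0Pn[v]; rewrite inE => /andP[vV /eqP <-].
apply: map_f; suff -> : s =i V by [].
have sE : size s = #|[set x in s]| by rewrite cardsE; apply/esym/card_uniqP.
have /eqP E : [set x in s] == V.
  rewrite eqEcard -sE cV leqnn andbT; apply/subsetP => x; rewrite inE; exact: sV.
by move=> x; rewrite -E inE.
Qed.

(** Distinct colors enlarge each class by at most one. If k vertices are deleted, the ceiling rises
    by one and the residue stays, so a full class was full before. Otherwise the rest has a multiple
    of k vertices, and only the colors of [s], n mod* k in number, can become full. *)
Lemma colorable_del k L (V : {set T}) s : list_assignment k L ->
  0 < size s <= k -> uniq s -> {subset s <= V} ->
  size s = k \/ k %| #|V| - size s ->
  slots (del V s) k 0 s -> colorable k L (del V s) -> colorable k L V.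
Proof.
move=> kL /andP[s0 sk] us sV sizes sl [f [fL fe fSE]].
have sW : {in s, forall x, x \notin del V s} by move=> x xs; rewrite mem_del xs.
have [//|g [gf gL gW _ gu]] := greedy_extension f (used := [::]) kL us sW _ sl.
have gfW : {in del V s, g =1 f} by move=> x; rewrite mem_del => /andP[xs _]; apply: gf.
have inW x : x \in V -> x \notin s -> x \in del V s by rewrite mem_del => -> ->.
have clsE c : #|cls g (del V s) c| = #|cls f (del V s) c|.
  by apply: eq_card => v; rewrite !inE -mem_del; case: (boolP (v \in _)) => // /gfW->.
exists g; split.
- move=> v vV; case: (boolP (v \in s)) => [/gL //|vs]; rewrite gfW ?fL //; exact: inW.
- move=> u v uV vV uv.
  case: (boolP (u \in s)) => us'; case: (boolP (v \in s)) => vs'.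
  + apply: contraTneq uv => /(uniq_map_in_inj gu us' vs') ->; by rewrite irr.
  + by apply: gW => //; apply: inW.
  + by rewrite eq_sym; apply: gW; rewrite ?inW // sym.
  + by rewrite !gfW ?fe ?inW.
move=> q m /andP[m0 mk] cV.
have cW := card_del us sV.
have clsV c : #|cls g V c| <= #|cls f (del V s) c| + (c \in map g s).
  by rewrite -clsE; apply: card_cls_del.
have small : #|del V s| = 0 -> forall c, #|cls f (del V s) c| = 0.
  move=> W0 c; apply/eqP; rewrite -leqn0 -W0; apply: subset_leq_card.
  by apply/subsetP => v; rewrite inE => /andP[].
have sub_s t : uniq t -> {subset t <= map g s} -> size t <= size s.
  by move=> ut /(uniq_leq_size ut); rewrite size_map.
(* [SE_on] says nothing about an empty rest, so that case is separate. *)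
have [W0|Wpos] := posnP #|del V s|.
  have q0 : q = 0 by nia.
  have sm : size s = m by nia.
  rewrite q0; split=> [c|t ut tc]; first by rewrite (leq_trans (clsV c)) // small // leq_b1.
  rewrite -sm; apply: sub_s => // c /tc cc; apply: (@cls_sub_map _ V) => //; last by rewrite cc.
  by rewrite cW W0.
case: (eqVneq (size s) k) => [sE|sNE].
  have [q' qE] : exists q', q = q'.+1 by exists q.-1; nia.
  have [||c1 c2] := fSE q' m; [by rewrite m0 | by nia |].
  rewrite qE; split=> [c|t ut tc].
    by rewrite (leq_trans (clsV c)) // -addn1 leq_add // leq_b1.
  apply: c2 => // c /tc cc; have := clsV c; have := c1 c; rewrite cc; case: (c \in _); lia.
(* The rest has residue k, not 0, and classes of at most [r.+1] vertices. *)
have [r rE] : exists r, #|del V s| = k * r.+1.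
  case: sizes => [sE|/dvdnP[r]]; first by rewrite sE eqxx in sNE.
  rewrite cW addnK => dE; exists r.-1; rewrite dE prednK 1?mulnC //.
  by case: r dE => // dE; rewrite dE in Wpos.
have [qE mE] : q = r.+1 /\ m = size s.
  by apply: (@division_unique k); rewrite ?m0 ?s0 // -cV cW rE.
have [||c1 _] := fSE r k; [by lia | by rewrite rE; nia |].
rewrite qE mE; split=> [c|t ut tc].
  by rewrite (leq_trans (clsV c)) // -addn1 leq_add // leq_b1.
apply: sub_s => // c /tc cc; have := clsV c; have := c1 c; rewrite cc; case: (c \in _); lia.
Qed.

(** * The potential and its behaviour under deletion *)

Implicit Types (U V W A X Y : {set T}).

Definition excess (V : {set T}) := \sum_(x in V) (dg V x - 2).

(** A nonempty union of cycle components of G[V]. *)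
Definition cyc (V A : {set T}) :=
  [/\ A != set0, A \subset V & {in A, forall v, dg V v = 2 /\ nb V v \subset A}].

Definition hits (V X : {set T}) :=
  forall A, cyc V A -> exists2 x, x \in A & x \in X.

(* [Wle V w] bounds by w the potential W(V): X meets all cycle components. *)
Definition Wle V w := exists2 X, hits V X & excess V + #|X| <= w.

Lemma Wle_leq V w w' : w <= w' -> Wle V w -> Wle V w'.
Proof. by move=> ww' [X hX le]; exists X => //; apply: leq_trans ww'. Qed.

Lemma nb_del1 V v y : nb (V :\ v) y = nb V y :\ v.
Proof. by apply/setP => z; rewrite !inE andbA. Qed.

Lemma dg_del1 V v y : v \in V -> dg V y = dg (V :\ v) y + e y v.
Proof.
by move=> vV; rewrite /dg nb_del1 (cardsD1 v (nb V y)) addnC inE vV.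
Qed.

Lemma dg_subset U V x : U \subset V -> dg U x <= dg V x.
Proof.
move=> /subsetP UV; apply: subset_leq_card; apply/subsetP => y.
by rewrite !inE => /andP[/UV -> ->].
Qed.

Lemma card_setIdE A (P : pred T) : #|[set y in A | P y]| = \sum_(y in A) P y.
Proof. by rewrite -sum1dep_card big_mkcondr; apply: eq_bigr => y _; case: (P y). Qed.

Lemma excess_del1 V v : v \in V ->
  excess V = excess (V :\ v) + (dg V v - 2) + #|[set y in nb V v | 2 < dg V y]|.
Proof.
move=> vV; rewrite /excess (big_setD1 v) //= addnAC [RHS]addnC; congr (_ + _).
have -> : [set y in nb V v | 2 < dg V y] = [set y in V :\ v | e v y && (2 < dg V y)].
  apply/setP => y; rewrite !inE; case: eqP => [->|_]; first by rewrite irr !andbF.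
  by rewrite andbA.
rewrite card_setIdE -big_split /=; apply: eq_bigr => y _.
by rewrite (dg_del1 y vV) sym; case: (e v y) => /=; lia.
Qed.

Lemma cyc_del1 V v A : cyc (V :\ v) A -> {in A, forall y, y \notin nb V v} -> cyc V A.
Proof.
move=> [A0 /subsetP AV Ad] Anb; split=> // [|y yA].
  by apply/subsetP => y /AV; rewrite inE => /andP[].
have [dy ny] := Ad y yA.
have yv : e y v = false.
  apply: contraNF (Anb y yA) => yv; rewrite inE sym yv andbT.
  by have := AV _ yA; rewrite inE => /andP[].
have E : nb V y = nb (V :\ v) y.
  by apply/setP => z; rewrite !inE; case: eqP => [->|]; rewrite ?yv ?andbF.
by rewrite /dg E.
Qed.

Lemma cyc_del1_dg V v A y : v \in V -> cyc (V :\ v) A -> y \in A -> y \in nb V v ->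
  dg V y = 3.
Proof.
move=> vV [_ _ Ad] /Ad[dy _]; rewrite inE => /andP[_ vy].
by rewrite (dg_del1 y vV) dy sym vy.
Qed.

Lemma hits_del1 V X Y v : v \in V -> hits V X ->
  (forall A, cyc (V :\ v) A -> forall y, y \in A -> y \in nb V v ->
     exists2 x, x \in A & x \in Y) ->
  hits (V :\ v) (X :\ v :|: Y).
Proof.
move=> vV hX hY A cA; have [|H] := boolP [exists y in A, y \in nb V v].
  by move=> /exists_inP[y yA /(hY A cA y yA)[x xA xY]]; exists x; rewrite // inE xY orbT.
have [|x xA xX] := hX A; first by apply: cyc_del1 cA _ => y yA; move/exists_inPn: H => ->.
exists x => //; rewrite !inE xX andbT; have [_ /subsetP AV _] := cA.
by have := AV _ xA; rewrite !inE => /andP[-> _].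
Qed.

(** A new cycle component contains a neighbour of [v] that had degree exactly 3. The unit of excess
    lost by that neighbour pays for putting it into the hitting set, so only neighbours of degree at
    least 4 give a net gain. *)
Lemma Wle_del1 V v w : v \in V -> Wle V w ->
  Wle (V :\ v) (w - ((dg V v - 2) + #|[set y in nb V v | 3 < dg V y]|)).
Proof.
move=> vV [X hX le].
pose Y := [set y in nb V v | dg V y == 3].
have Z : #|[set y in nb V v | 2 < dg V y]| = #|Y| + #|[set y in nb V v | 3 < dg V y]|.
  by rewrite !card_setIdE -big_split /=; apply: eq_bigr => y _; lia.
exists (X :\ v :|: Y).
  apply: hits_del1 hX _ => // A cA y yA yv; exists y => //.
  by rewrite inE yv (cyc_del1_dg vV cA yA yv).
move: Y Z => Y Z; have := excess_del1 vV; rewrite Z.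
have [+ _] := leq_card_setU (X :\ v) Y; have := subset_leq_card (subD1set X v); lia.
Qed.

Lemma Wle_mono1 V v w : v \in V -> Wle V w -> Wle (V :\ v) w.
Proof. by move=> vV /(Wle_del1 vV); apply: Wle_leq; lia. Qed.

Lemma Wle_del1_hub V v w : v \in V -> Wle V w -> Wle (V :\ v) (w - (dg V v - 2)).
Proof. by move=> vV /(Wle_del1 vV); apply: Wle_leq; lia. Qed.

Lemma Wle_del1_nb4 V v y w : v \in V -> y \in V -> e v y -> 3 < dg V y ->
  Wle V w -> Wle (V :\ v) (w - 1).
Proof.
move=> vV yV vy dy /(Wle_del1 vV); apply: Wle_leq.
suff : 0 < #|[set y in nb V v | 3 < dg V y]| by lia.
by apply/card_gt0P; exists y; rewrite !inE yV vy.
Qed.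

(** The obstruction to [Wle_del1_low]: if a deletion puts the hub [y] on a cycle component whose
    other vertices were low, then [z] and [z'] are the next two vertices on it. *)
Definition pendant_path V y z z' :=
  [&& y \in V, z \in V, z' \in V, e y z, e z z', dg V y == 3, dg V z <= 2 & dg V z' <= 2].

(** If [y] has degree 3, the hub neighbours of [x] other than [y] serve as hitting set, which saves
    one unit. They could miss only a new cycle component through [y] with all other vertices low in
    [V], and that contains a pendant path. *)
Lemma Wle_del1_low V x y : (forall y z z', ~~ pendant_path V y z z') -> hits V set0 ->
  x \in V -> y \in V -> e x y -> dg V x <= 2 -> 2 < dg V y ->
  Wle (V :\ x) (excess V - 1).
Proof.
move=> noP h0 xV yV xy dx dy; have [dy4|dy3] := ltnP 3 (dg V y).
  by apply: (Wle_del1_nb4 xV yV) => //; exists set0; rewrite // cards0 addn0.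
have {}dy : dg V y = 3 by lia.
pose Y := [set u in nb V x | 2 < dg V u].
exists (set0 :\ x :|: (Y :\ y)); last first.
  have := excess_del1 xV; rewrite set0D set0U -/Y (cardsD1 y Y) !inE yV xy dy /=; lia.
apply: hits_del1 h0 _ => // A cA u uA ux.
have [uy|uy] := eqVneq u y; last first.
  by exists u; rewrite // !inE uy (cyc_del1_dg xV cA uA ux) andbT; rewrite !inE in ux.
have {u uA ux uy} yA : y \in A by rewrite -uy.
have [_ /subsetP AV Ad] := cA.
have [//|noY] := classic (exists2 z, z \in A & z \in Y :\ y).
have lowA z : z \in A -> z != y -> dg V z <= 2.
  move=> zA zy; have [dz _] := Ad z zA; rewrite (dg_del1 z xV) dz.
  case: (boolP (e z x)) => // zx; case: noY; exists z => //.
  rewrite !inE zy sym zx (dg_del1 z xV) dz zx !andbT /=.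
  by have := AV _ zA; rewrite inE => /andP[].
have ex_nb u : u \in A -> exists z, [/\ z \in A, e u z & z \in V].
  move=> uA; have [du /subsetP nu] := Ad u uA.
  have /card_gt0P[z zu] : 0 < #|nb (V :\ x) u| by rewrite -/(dg _ _) du.
  exists z; rewrite nu //; move: zu; rewrite !inE => /andP[/andP[_ ->] ->]; by [].
have [z [zA yz zV]] := ex_nb y yA.
have zy : z != y by apply: contraTneq yz => ->; rewrite irr.
have [dz /subsetP nz] := Ad z zA.
have /card_gt0P[z' zz'] : 0 < #|nb (V :\ x) z :\ y|.
  have := cardsD1 y (nb (V :\ x) z); rewrite -/(dg _ _) dz; case: (y \in _); lia.
have {zz'} [z'y z'n] : z' != y /\ z' \in nb (V :\ x) z.
  by move: zz'; rewrite in_setD1 => /andP.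
have z'A := nz _ z'n.
have [z'V zz'] : z' \in V /\ e z z' by move: z'n; rewrite !inE => /andP[/andP[_ ->] ->].
by have /negP[] := noP y z z'; rewrite /pendant_path yV zV z'V yz zz' dy !lowA.
Qed.

(** Shrink the hitting set while it still hits. A vertex [v] that cannot be dropped is needed for
    some [A]; its neighbours have degree 2, so deleting it creates no new cycle component. *)
Lemma Wle_cases V w : Wle V w -> (hits V set0 /\ excess V <= w) \/
  exists A v, [/\ cyc V A, v \in A & Wle (V :\ v) (w - 1)].
Proof.
case=> X; have [m] := ubnP #|X|; elim: m X => // m IH X Xm hX le.
have [X0|[v vX]] := set_0Vmem X.
  by left; split; [rewrite -X0 | rewrite X0 cards0 addn0 in le].
have cX := cardsD1 v X; rewrite vX in cX.
have [h|h] := classic (hits V (X :\ v)); first by apply: (IH _ _ h); lia.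
right; have {h}[A h] := not_all_ex_not _ _ h.
have {h}[cA nA] := imply_to_and _ _ h.
have vA : v \in A.
  have [x xA xX] := hX A cA; have [<- //|xv] := eqVneq x v.
  by case: nA; exists x; rewrite // !inE xv.
exists A, v; split=> //; have [_ /subsetP AV Ad] := cA; have vV := AV v vA.
exists (X :\ v); last by have := excess_del1 vV; lia.
rewrite -[X :\ v]setU0; apply: hits_del1 => // A' cA' y yA' yv.
have [_ /subsetP nv] := Ad v vA.
by have := cyc_del1_dg vV cA' yA' yv; have [->] := Ad y (nv _ yv).
Qed.

(** * Consequences of 2-degeneracy *)

Definition degenerate2 := forall A, A != set0 -> exists2 v, v \in A & dg A v <= 2.

(** Apply degeneracy to the set of hubs: a hub with at most two hub neighbours has a low one. *)
Lemma low_hub V : degenerate2 -> 0 < excess V ->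
  exists x y, [/\ x \in V, y \in V, e x y, dg V x <= 2 & 2 < dg V y].
Proof.
move=> deg2 ex; pose H := [set y in V | 2 < dg V y].
have [H0|] := eqVneq H set0.
  suff: excess V = 0 by lia.
  apply: big1 => y yV; apply/eqP; rewrite subn_eq0 leqNgt.
  by have := in_set0 y; rewrite -H0 inE yV => /= ->.
move=> /deg2[y yH dy]; have := yH; rewrite inE => /andP[yV dyV].
have /subsetPn[x] : ~~ (nb V y \subset nb H y).
  by apply: contraTN dyV => /subset_leq_card; rewrite -/(dg _ _) -/(dg _ _); lia.
rewrite !inE => /andP[xV yx]; rewrite xV yx andbT -leqNgt => dx.
by exists x, y; split; rewrite // sym.
Qed.

(** Without cycle components, take a low vertex next to a hub: delete the low vertex if the hub has
    degree at least 4, and the hub itself if it has degree 3. *)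
Lemma Wle_del1_deg3 V w : degenerate2 -> V != set0 -> Wle V w ->
  exists x, [/\ x \in V, dg V x <= 3 & Wle (V :\ x) (w - 1)].
Proof.
move=> deg2 V0 /Wle_cases[[h0 le]|[A [v [[_ /subsetP AV Ad] vA Wv]]]]; last first.
  by exists v; rewrite AV //; split=> //; have [->] := Ad v vA.
have WV : Wle V w by exists set0; rewrite // cards0 addn0.
have [e0|epos] := posnP (excess V).
  have [x xV dx] := deg2 V V0; exists x; split=> //; first exact: leqW.
  have W0 : Wle V 0 by exists set0; rewrite // cards0 addn0 e0.
  by apply: Wle_leq (Wle_mono1 xV W0).
have [x [y [xV yV xy dx dy]]] := low_hub deg2 epos.
have [dy4|dy3] := ltnP 3 (dg V y).
  by exists x; split=> //; [exact: leqW | apply: Wle_del1_nb4 dy4 WV].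
by exists y; split=> //; have := Wle_del1_hub yV WV; apply: Wle_leq; lia.
Qed.

Lemma Wle_subset U V w : U \subset V -> Wle V w -> Wle U w.
Proof.
have [m] := ubnP #|V :\: U|; elim: m V => // m IH V Vm UV WV.
have [E|[v]] := set_0Vmem (V :\: U).
  by have -> : U = V by apply/eqP; rewrite eqEsubset UV -setD_eq0 E eqxx.
rewrite inE => /andP[vU vV]; apply: IH (Wle_mono1 vV WV).
  rewrite -ltnS (leq_trans _ Vm) // ltnS proper_card //; apply/properP; split.
    by apply: setSD; apply: subD1set.
  by exists v; rewrite !inE ?vU ?vV ?eqxx.
apply/subsetP => u uU; rewrite !inE (subsetP UV) // andbT.
by apply: contraNneq vU => <-.
Qed.

(** * Removable lists *)

Definition removable k V s w :=
  [/\ uniq s, all [in V] s, slots (del V s) k 0 s & Wle (del V s) w].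

Lemma del_subset V s t : {subset t <= s} -> del V s \subset del V t.
Proof.
by move=> ts; apply/subsetP => x; rewrite !mem_del => /andP[xs ->]; rewrite (contra (@ts x)).
Qed.

Lemma del_subset1 V s x : x \in s -> del V s \subset V :\ x.
Proof.
move=> xs; apply/subsetP => y; rewrite mem_del !inE => /andP[ys ->].
by rewrite andbT; apply: contraNneq ys => ->.
Qed.

Lemma slots_subset U W k i s : U \subset W -> slots W k i s -> slots U k i s.
Proof.
move=> UW; elim: s i => //= x s IH i /andP[dx /IH->]; rewrite andbT.
by apply: leq_ltn_trans dx; rewrite leq_add2r dg_subset.
Qed.

Lemma slots_succ W k i s : slots W k.+1 i.+1 s = slots W k i s.
Proof. by elim: s i => //= x s IH i; rewrite IH addnS ltnS. Qed.

Lemma dg_del V s x t : uniq t -> all (fun y => [&& y \in V, e x y & y \in s]) t ->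
  dg (del V s) x + size t <= dg V x.
Proof.
move=> /card_uniqP ut /allP tx; rewrite -ut -[#|t|]cardsE addnC.
have ts : [set y in t] \subset nb V x.
  by apply/subsetP => y; rewrite !inE => /tx/and3P[-> ->].
rewrite /dg -(subnKC (subset_leq_card ts)) leq_add2l -cardsDS //.
apply: subset_leq_card; apply/subsetP => y; rewrite !inE => /andP[/andP[ys ->] ->].
by rewrite !andbT; apply: contra ys => /tx/and3P[].
Qed.

Lemma dg_del0 V s x : dg (del V s) x <= dg V x.
Proof. by apply: dg_subset; apply: subsetDl. Qed.

Lemma dg_del2 V s x y : y \in V -> e x y -> y \in s -> dg (del V s) x + 1 <= dg V x.
Proof. by move=> yV xy ys; apply: (@dg_del V s x [:: y]); rewrite //= yV xy ys. Qed.

Lemma dg_del3 V s x y z : y \in V -> e x y -> y \in s -> z \in V -> e x z -> z \in s ->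
  y != z -> dg (del V s) x + 2 <= dg V x.
Proof.
move=> yV xy ys zV xz zs yz; apply: (@dg_del V s x [:: y; z]); rewrite /= ?inE ?yz //.
by rewrite yV xy ys zV xz zs.
Qed.

Lemma adj_neq x y : e x y -> x != y.
Proof. by apply: contraTneq => ->; rewrite irr. Qed.

Lemma dg_neq V x y m : dg V x <= m -> m < dg V y -> x != y.
Proof. by move=> dx; apply: contraTneq => <-; rewrite -leqNgt. Qed.

Lemma mem_nb V x y : (y \in nb V x) = (y \in V) && e x y.
Proof. by rewrite inE. Qed.

Lemma nbP V x : reflect (exists2 y, y \in V & e x y) (0 < dg V x).
Proof.
apply: (iffP card_gt0P) => [[y]|[y yV xy]]; last by exists y; rewrite mem_nb yV.
by rewrite mem_nb => /andP[]; exists y.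
Qed.

Lemma nb2P V x y : y \in V -> e x y -> 1 < dg V x ->
  exists z, [/\ z \in V, e x z & z != y].
Proof.
move=> yV xy; rewrite /dg (cardsD1 y) mem_nb yV xy ltnS => /card_gt0P[z].
by rewrite in_setD1 mem_nb => /and3P[]; exists z.
Qed.

(** Both excluded configurations are reducible by themselves, see [removable_cyc] and
    [reduces3_path]; without them [Wle_del1_low] applies. *)
Definition tame V := hits V set0 /\ forall y z z', ~~ pendant_path V y z z'.

Definition reduces3 j V := exists2 s, size s = j & removable 3 V s (excess V - 1).
Definition reduces4 j V := exists2 s, size s = j & removable 4 V s (excess V - 2).

Hypothesis deg2 : degenerate2.

Lemma del_neq0 V s : uniq s -> all [in V] s -> size s < #|V| -> del V s != set0.
Proof. by move=> us /allP sV; rewrite (card_del us sV) -card_gt0; lia. Qed.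

Lemma delC V s x : del V (x :: s) = del V s :\ x.
Proof. by apply/setP => y; rewrite !inE negb_or; case: eqP. Qed.

Lemma removable_cons k V s w x : all [in V] s -> uniq s -> x \in del V s ->
  slots (del V (x :: s)) k.+1 1 s -> dg (del V s) x <= k -> Wle (del V (x :: s)) w ->
  removable k.+1 V (x :: s) w.
Proof.
move=> sV us; rewrite mem_del => /andP[xs xV] sl dx WV; split; rewrite //= ?xs ?xV //.
rewrite sl andbT addn0 ltnS (leq_trans _ dx) // dg_subset // del_subset // => y ys.
by rewrite inE ys orbT.
Qed.

(** The fourth color makes up for one more vertex in front, which may keep three neighbours and
    lowers the bound once more. *)
Lemma removable_succ V s w : size s < #|V| -> removable 3 V s w ->
  exists x, removable 4 V (x :: s) (w - 1).
Proof.
move=> sV [us aV sl WV]; have [x [xV dx Wx]] := Wle_del1_deg3 deg2 (del_neq0 us aV sV) WV.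
exists x; apply: removable_cons; rewrite ?delC // slots_succ.
by apply: slots_subset sl; apply: subD1set.
Qed.

Lemma reduces_succ j V : j < #|V| -> reduces3 j V -> reduces4 j.+1 V.
Proof.
move=> jV [s sj rs]; have [|x rx] := removable_succ _ rs; first by rewrite sj.
by exists (x :: s); rewrite /= ?sj //; rewrite -subnDA in rx.
Qed.

Lemma strict_low V : tame V -> V != set0 ->
  exists x, [/\ x \in V, dg V x <= 2 & Wle (V :\ x) (excess V - 1)].
Proof.
move=> [h0 noP] V0; have [e0|epos] := posnP (excess V).
  have [x xV dx] := deg2 V0; exists x; split=> //.
  by apply: Wle_mono1 => //; exists set0; rewrite // cards0 e0.
have [x [y [xV yV xy dx dy]]] := low_hub deg2 epos.
by exists x; split=> //; apply: Wle_del1_low dy.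
Qed.

(** The list [s] leaves position 0 free. If the vertex that lowers the potential already lies in
    [s], the drop is secured and any vertex of degree at most 2 in the rest can fill that
    position. *)
Lemma removable_low V s : tame V -> uniq s -> all [in V] s -> size s < #|V| ->
  slots (del V s) 3 1 s -> exists x, removable 3 V (x :: s) (excess V - 1).
Proof.
move=> tV us sV cV sl; have Vs := del_neq0 us sV cV.
have V0 : V != set0 by rewrite -card_gt0; lia.
have sl' x : slots (del V (x :: s)) 3 1 s.
  by apply: slots_subset sl; rewrite delC subD1set.
have [x [xV dx Wx]] := strict_low tV V0.
case: (boolP (x \in s)) => xs; last first.
  exists x; apply: removable_cons; rewrite ?mem_del ?xs //.
    by rewrite (leq_trans (dg_del0 _ _ _)).
  by apply: Wle_subset Wx; apply: del_subset1; rewrite mem_head.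
have [z zV dz] := deg2 Vs; exists z; apply: removable_cons => //.
by apply: Wle_subset Wx; apply: del_subset1; rewrite inE xs orbT.
Qed.

(* [lia] splits on every boolean atom of the context, so the irrelevant ones are cleared. *)
Ltac split_lia := intros; repeat match goal with
  | H : is_true (_ \in _) |- _ => clear H
  | H : is_true (e _ _) |- _ => clear H
  | H : is_true (_ != _) |- _ => clear H
  end; repeat (apply/andP; split); try done; lia.

Ltac side := solve [done | by rewrite sym | by rewrite eq_sym | by rewrite !inE ?eqxx ?orbT].

Lemma Wle_excess V : tame V -> Wle V (excess V).
Proof. by move=> [h0 _]; exists set0; rewrite // cards0 addn0. Qed.

(** * Basic reducible configurations *)

Lemma removable_cyc V A v w : cyc V A -> v \in A -> Wle (V :\ v) w ->
  exists2 s, size s = 3 & removable 3 V s w.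
Proof.
move=> [_ /subsetP AV Ad] vA Wv; have vV := AV v vA; have [dv /subsetP nv] := Ad v vA.
have [u uV vu] : exists2 u, u \in V & e v u by apply/nbP; rewrite dv.
have [|u' [u'V vu' u'u]] := nb2P uV vu; first by rewrite dv.
have dn y : y \in V -> e v y -> dg V y = 2.
  by move=> yV vy; have [|->] := Ad y; rewrite // nv // mem_nb yV.
exists [:: u; u'; v] => //; split=> /=.
- by rewrite !inE negb_or eq_sym u'u /= ![_ == v]eq_sym !adj_neq.
- by rewrite uV u'V vV.
- have : dg (del V [:: u; u'; v]) u + 1 <= dg V u by apply: (@dg_del2 _ _ _ v); side.
  have : dg (del V [:: u; u'; v]) u' + 1 <= dg V u' by apply: (@dg_del2 _ _ _ v); side.
  have : dg (del V [:: u; u'; v]) v + 2 <= dg V v by apply: (@dg_del3 _ _ _ u u'); side.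
  rewrite dv !dn //; lia.
- by apply: Wle_subset Wv; apply: del_subset1; rewrite !inE eqxx !orbT.
Qed.

Lemma reduces3_path V y z z' : hits V set0 -> pendant_path V y z z' -> reduces3 3 V.
Proof.
move=> h0 /and5P[yV zV z'V yz /and4P[zz' /eqP dy dz dz']].
have yz' : z' != y by apply: (@dg_neq V _ _ 2); rewrite ?dy.
have zy : e z y by rewrite sym.
exists [:: y; z'; z] => //; split=> /=.
- by rewrite !inE negb_or eq_sym yz' adj_neq //= eq_sym adj_neq.
- by rewrite yV zV z'V.
- have : dg (del V [:: y; z'; z]) y + 1 <= dg V y by apply: (@dg_del2 _ _ _ z); side.
  have : dg (del V [:: y; z'; z]) z' + 1 <= dg V z' by apply: (@dg_del2 _ _ _ z); side.
  have : dg (del V [:: y; z'; z]) z + 2 <= dg V z by apply: (@dg_del3 _ _ _ z' y); side.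
  lia.
- have W0 : Wle V (excess V) by exists set0; rewrite // cards0 addn0.
  have := Wle_del1_hub yV W0; rewrite dy; apply: Wle_subset.
  by apply: del_subset1; rewrite mem_head.
Qed.

Lemma reduces3_deg1 V v : tame V -> 1 < #|V| -> v \in V -> dg V v <= 1 -> reduces3 2 V.
Proof.
move=> tV cV vV dv; have [||||x rx] := @removable_low V [:: v] tV => //=.
- by rewrite vV.
- by rewrite andbT addn1 !ltnS (leq_trans (dg_del0 _ _ _)).
by exists [:: x; v].
Qed.

Lemma reduces3_low_low V x y h : tame V -> [/\ x \in V, y \in V & h \in V] ->
  e x y -> e x h -> dg V x <= 2 -> dg V y <= 2 -> 2 < dg V h -> reduces3 2 V.
Proof.
move=> [h0 noP] [xV yV hV] xy xh dx dy dh; exists [:: x; y] => //; split=> /=.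
- by rewrite !inE adj_neq.
- by rewrite xV yV.
- have : dg (del V [:: x; y]) x + 1 <= dg V x by apply: (@dg_del2 _ _ _ y); side.
  have : dg (del V [:: x; y]) y + 1 <= dg V y by apply: (@dg_del2 _ _ _ x); side.
  lia.
- apply: Wle_subset (Wle_del1_low noP h0 xV hV xh dx dh).
  by apply: del_subset1; rewrite mem_head.
Qed.

(** * Irreducible structure and discharging *)

Definition hub_free V v := (dg V v <= 2) && [forall u in nb V v, dg V u <= 2].

(* The vertices far from the hubs form a closed set, so that they would contain a cycle
   component unless one of them has degree less than 2. *)
Lemma no_hub_free V : hits V set0 ->
  (forall v, v \in V -> hub_free V v -> 1 < dg V v /\ {in nb V v, forall u, hub_free V u}) ->
  forall v, v \in V -> ~~ hub_free V v.
Proof.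
move=> h0 H v vV; apply/negP => fv.
have [|x _] := h0 [set u in V | hub_free V u]; last by rewrite inE.
split; [by apply/set0Pn; exists v; rewrite inE vV|by apply/subsetP=> u; rewrite inE => /andP[]|].
move=> u; rewrite inE => /andP[uV fu]; have [du nu] := H u uV fu; split.
  by apply/eqP; rewrite eqn_leq du andbT; case/andP: fu.
by apply/subsetP => z zn; rewrite inE (nu z zn) andbT; move: zn; rewrite mem_nb => /andP[].
Qed.

Lemma hub_nbP V v : dg V v <= 2 -> ~~ hub_free V v ->
  exists2 h, h \in V /\ e v h & 2 < dg V h.
Proof.
move=> dv; rewrite /hub_free dv => /forall_inPn[h]; rewrite mem_nb -ltnNge => /andP[hV vh] dh.
by exists h.
Qed.

(** Each violation yields a pair to delete: a vertex of degree at most 1 with a suitable low vertex,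
    two adjacent low vertices one of which sees a hub, or a low vertex with a hub of degree 3. *)
Lemma irreducible2 V : tame V -> 1 < #|V| -> ~ reduces3 2 V ->
  forall v, v \in V -> dg V v <= 2 -> dg V v = 2 /\ {in nb V v, forall h, 3 < dg V h}.
Proof.
move=> tV cV nr; have [h0 _] := tV.
have d2 v : v \in V -> 1 < dg V v.
  by move=> vV; rewrite ltnNge; apply/negP => dv; apply: nr; apply: reduces3_deg1 dv.
have nf : forall v, v \in V -> ~~ hub_free V v.
  apply: no_hub_free => // v vV /andP[dv /forall_inP fv]; split; first exact: d2.
  move=> u un; have du := fv u un; rewrite /hub_free du; apply/forall_inP => h.
  rewrite mem_nb => /andP[hV uh]; rewrite leqNgt; apply/negP => dh; apply: nr.
  move: un; rewrite mem_nb sym => /andP[uV uv].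
  exact: (@reduces3_low_low V u v h).
move=> v vV dv; split; first by have := d2 v vV; lia.
have [h [hV vh] dh] := hub_nbP dv (nf v vV).
move=> u; rewrite mem_nb => /andP[uV vu]; rewrite ltnNge; apply/negP => du; apply: nr.
have [du2|du3] := leqP (dg V u) 2; first exact: (@reduces3_low_low V v u h).
have {}du : dg V u = 3 by lia.
exists [:: u; v] => //; split=> /=.
- by rewrite !inE eq_sym adj_neq.
- by rewrite uV vV.
- have : dg (del V [:: u; v]) u + 1 <= dg V u by apply: (@dg_del2 _ _ _ v); side.
  have : dg (del V [:: u; v]) v + 1 <= dg V v by apply: (@dg_del2 _ _ _ u); side.
  lia.
- have := Wle_del1_hub uV (Wle_excess tV); rewrite du; apply: Wle_subset.
  by apply: del_subset1; rewrite mem_head.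
Qed.

Definition lownb V h := [set v in nb V h | dg V v <= 2].
Definition hubnb V v := [set h in nb V v | 2 < dg V h].

(** Every vertex starts with charge 2, and low vertices hand theirs over to the hubs. *)
Lemma discharge V (wt : T -> T -> nat) :
  (forall v, v \in V -> dg V v <= 2 -> 2 <= \sum_(h in hubnb V v) wt v h) ->
  2 * #|V| <= \sum_(h in V | 2 < dg V h) (2 + \sum_(v in lownb V h) wt v h).
Proof.
move=> low; rewrite big_split /= [X in _ + X](exchange_big_dep
  (fun v => (v \in V) && (dg V v <= 2))) /=; last first.
  by move=> h v; rewrite !inE => _ /andP[/andP[-> _] ->].
rewrite mulnC -sum_nat_const (bigID (fun v => 2 < dg V v)) /= leq_add2l.
under eq_bigl do rewrite -leqNgt.
apply: leq_sum => v /andP[vV dv]; apply: leq_trans (low v vV dv) _.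
rewrite leq_eqVlt; apply/orP; left; apply/eqP; apply: eq_bigl => h.
by rewrite !inE vV dv andbT /= sym; case: (h \in V); case: (2 < _); rewrite ?andbT ?andbF.
Qed.

Lemma excess_hubs V : excess V = \sum_(h in V | 2 < dg V h) (dg V h - 2).
Proof.
rewrite /excess (bigID (fun h => 2 < dg V h)) /= [X in _ + X]big1 ?addn0 // => v /andP[_].
by rewrite -leqNgt -subn_eq0 => /eqP.
Qed.

Lemma card_lownb V h : #|lownb V h| <= dg V h.
Proof. by apply: subset_leq_card; apply/subsetP => v; rewrite inE => /andP[]. Qed.

(** [c * (dg V h - 2)] is the capacity of a hub. The bounds compare 3 or 2 times the excess with n,
    hence [c] is 6 or 4; the slack [d] is meant to beat the additive constants. *)
Lemma discharge_slack V (wt : T -> T -> nat) (d : T -> nat) c :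
  (forall v, v \in V -> dg V v <= 2 -> 2 <= \sum_(h in hubnb V v) wt v h) ->
  (forall h, h \in V -> 2 < dg V h ->
     2 + \sum_(v in lownb V h) wt v h + d h <= c * (dg V h - 2)) ->
  2 * #|V| + \sum_(h in V | 2 < dg V h) d h <= c * excess V.
Proof.
move=> /discharge low hub; rewrite excess_hubs big_distrr /=.
apply: leq_trans (leq_add low (leqnn _)) _; rewrite -big_split /=.
by apply: leq_sum => h /andP[hV dh]; apply: hub.
Qed.

Definition hubs V := [set h in V | 2 < dg V h].

Lemma sum_hubs_const V d : \sum_(h in V | 2 < dg V h) d = #|hubs V| * d.
Proof. by rewrite -sum_nat_const; apply: eq_bigl => h; rewrite inE. Qed.

Lemma sum_lownb_le V h m (w : T -> nat) : (forall v, v \in lownb V h -> w v <= m) ->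
  \sum_(v in lownb V h) w v <= #|lownb V h| * m.
Proof. by move=> le; rewrite -sum_nat_const; apply: leq_sum. Qed.

Lemma exists_hub V : V != set0 -> (forall v, v \in V -> ~~ hub_free V v) ->
  0 < #|hubs V|.
Proof.
move=> /set0Pn[v vV] nf; apply/card_gt0P; have [dv|dv] := leqP (dg V v) 2.
  by have [h [hV _] dh] := hub_nbP dv (nf v vV); exists h; rewrite inE hV.
by exists v; rewrite inE vV.
Qed.

Lemma hub_free_all V v : v \in V -> 0 < dg V v -> {in nb V v, forall h, 2 < dg V h} ->
  ~~ hub_free V v.
Proof.
move=> vV /nbP[u uV vu] hv; apply/negP => /andP[_ /forall_inP fv].
have un : u \in nb V v by rewrite mem_nb uV.
by have := fv u un; rewrite leqNgt hv.
Qed.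

(** * Discharging for two or three deleted vertices, with k = 3 and then k = 4 *)

Lemma reduces3_2 V : tame V -> 1 < #|V| -> 3 * excess V <= #|V| + 1 -> reduces3 2 V.
Proof.
move=> tV cV le; apply: NNPP => nr; have low := irreducible2 tV cV nr.
have hub h v : v \in lownb V h -> h \in V -> 3 < dg V h.
  rewrite inE mem_nb => /andP[/andP[vV hv] dv] hV.
  by have [_ ->] := low v vV dv; rewrite // mem_nb hV sym.
have hubs_gt0 : 0 < #|hubs V|.
  apply: exists_hub => [|v vV]; first by rewrite -card_gt0; lia.
  have [dv|dv] := leqP (dg V v) 2; last by rewrite /hub_free leqNgt dv.
  have [d2 hv] := low v vV dv; apply: hub_free_all; rewrite ?d2 // => h /hv; exact: ltnW.
(* The hypothesis bounds the right side by [2 * #|V| + 2], so slack 4 at one hub is a contradiction.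
   A hub of degree 3 has no low neighbour and exactly uses its capacity 6. *)
suff : 2 * #|V| + \sum_(h in V | 2 < dg V h) 4 <= 6 * excess V.
  by rewrite sum_hubs_const; lia.
apply: (@discharge_slack V (fun _ _ => 1)) => [v vV dv|h hV dh].
  have [d2 hv] := low v vV dv; rewrite sum1_card -[X in X <= _]d2.
  by apply: subset_leq_card; apply/subsetP => h hn; rewrite inE hn ltnW ?hv.
rewrite sum1_card; have [E|[v /hub/(_ hV) dh4]] := set_0Vmem (lownb V h).
  by rewrite E cards0; lia.
by have := card_lownb V h; lia.
Qed.

Lemma tame_isolated V v : tame V -> v \in V -> dg V v = 0 ->
  tame (V :\ v) /\ excess (V :\ v) = excess V.
Proof.
move=> [h0 noP] vV dv; have nv y : y \in V -> e v y = false.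
  move=> yV; apply/negP => vy; suff: 0 < dg V v by rewrite dv.
  by apply/nbP; exists y.
have dE y : y \in V -> dg V y = dg (V :\ v) y.
  by move=> yV; rewrite (dg_del1 y vV) sym nv // addn0.
split; last first.
  rewrite [RHS](excess_del1 vV) dv sub0n addn0 -[LHS]addn0; congr (_ + _).
  apply/esym/eqP.
  rewrite cards_eq0 -subset0; apply/subsetP => y; rewrite !inE => /andP[/andP[yV]].
  by rewrite nv.
split=> [A cA|y z z'].
  apply: h0; apply: cyc_del1 cA _ => y _; apply/negP; rewrite mem_nb => /andP[yV].
  by rewrite nv.
apply: contra (noP y z z'); rewrite /pendant_path !inE.
case/and5P=> /andP[_ yV] /andP[_ zV] /andP[_ z'V] yz /and4P[zz' dy dz dz'].
by rewrite yV zV z'V yz zz' !dE // dy dz.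
Qed.

Lemma slots_rcons W k i s v :
  slots W k i (rcons s v) = slots W k i s && (dg W v + (i + size s) < k).
Proof. by elim: s i => [|x s IH] i /=; rewrite ?addn0 ?andbT // IH addSnnS andbA. Qed.

Lemma removable_isolated k V v s w : v \in V -> dg V v = 0 -> size s < k ->
  removable k (V :\ v) s w -> removable k V (rcons s v) w.
Proof.
move=> vV dv sk [us /allP sV sl WV].
have E : del V (rcons s v) = del (V :\ v) s.
  by apply/setP => y; rewrite !inE mem_rcons inE negb_or andbCA andbA.
have vs : v \notin s by apply/negP => /sV; rewrite !inE eqxx.
split; rewrite ?E ?rcons_uniq ?vs //.
  by rewrite all_rcons vV; apply/allP => y /sV; rewrite !inE => /andP[].
rewrite slots_rcons sl /= add0n (leq_ltn_trans _ sk) //.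
suff : dg (del (V :\ v) s) v <= dg V v by rewrite dv leqn0 => /eqP->.
by rewrite -E dg_del0.
Qed.

(** A leaf with a low neighbour could go last, after that neighbour. A hub-free vertex of degree 2
    with a neighbour that sees a hub could be deleted together with both its neighbours. *)
Lemma irreducible3 V : tame V -> 2 < #|V| -> (forall v, v \in V -> 0 < dg V v) ->
  ~ reduces3 3 V ->
  (forall v, v \in V -> dg V v <= 1 -> {in nb V v, forall h, 2 < dg V h}) /\
  (forall v, v \in V -> ~~ hub_free V v).
Proof.
move=> tV cV iso nr; have [h0 noP] := tV.
have leaf v : v \in V -> dg V v <= 1 -> {in nb V v, forall h, 2 < dg V h}.
  move=> vV dv u; rewrite mem_nb => /andP[uV vu]; rewrite ltnNge; apply/negP => du.
  apply: nr; have [||||x rx] := @removable_low V [:: u; v] tV => //=.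
  - by rewrite !inE eq_sym adj_neq.
  - by rewrite uV vV.
  - have : dg (del V [:: u; v]) u + 1 <= dg V u by apply: (@dg_del2 _ _ _ v); side.
    have : dg (del V [:: u; v]) v + 1 <= dg V v by apply: (@dg_del2 _ _ _ u); side.
    lia.
  by exists [:: x; u; v].
split=> //; apply: no_hub_free => // v vV fv; have [dv /forall_inP nv] := andP fv.
have {}dv : dg V v = 2.
  apply/eqP; rewrite eqn_leq dv ltnNge; apply/negP => d1.
  by have := hub_free_all vV (iso v vV) (leaf v vV d1); rewrite fv.
split=> [|u un]; first by rewrite dv.
have du := nv u un; move: un; rewrite mem_nb => /andP[uV vu].
apply/negP => /negP/(hub_nbP du)[h [hV uh] dh]; apply: nr.
have [|u' [u'V vu' u'u]] := nb2P uV vu; first by rewrite dv.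
have du' : dg V u' <= 2 by apply: nv; rewrite mem_nb u'V.
exists [:: u; u'; v] => //; split=> /=.
- by rewrite !inE negb_or eq_sym u'u /= ![_ == v]eq_sym !adj_neq.
- by rewrite uV u'V vV.
- have : dg (del V [:: u; u'; v]) u + 1 <= dg V u by apply: (@dg_del2 _ _ _ v); side.
  have : dg (del V [:: u; u'; v]) u' + 1 <= dg V u' by apply: (@dg_del2 _ _ _ v); side.
  have : dg (del V [:: u; u'; v]) v + 2 <= dg V v by apply: (@dg_del3 _ _ _ u u'); side.
  lia.
- apply: Wle_subset (Wle_del1_low noP h0 uV hV uh du dh).
  by apply: del_subset1; rewrite mem_head.
Qed.

Lemma card_hubnb_gt0 V v : dg V v <= 2 -> ~~ hub_free V v -> 0 < #|hubnb V v|.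
Proof.
move=> dv nf; have [h [hV vh] dh] := hub_nbP dv nf; apply/card_gt0P; exists h.
by rewrite !inE hV vh.
Qed.

Lemma card_hubnb V v : #|hubnb V v| <= dg V v.
Proof. by apply: subset_leq_card; apply/subsetP => h; rewrite inE => /andP[]. Qed.

Lemma one_hubnb V v h : #|hubnb V v| <= 1 -> v \in lownb V h -> h \in V -> 2 < dg V h ->
  dg V v <= 1 \/ exists z, [/\ z \in V, e v z, z != h & dg V z <= 2].
Proof.
rewrite [v \in _]inE mem_nb => cv /andP[/andP[vV hv] dv] hV dh.
have [d1|d2] := leqP (dg V v) 1; [by left | right].
have vh : e v h by rewrite sym.
have [z [zV vz zh]] := nb2P hV vh d2; exists z; split=> //.
rewrite leqNgt; apply/negP => dz; move: cv; rewrite leqNgt => /negP[].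
by apply/card_gt1P; exists h, z; rewrite !inE hV vh zV vz dh dz eq_sym zh.
Qed.

Lemma reduces3_leaf_hub3 V v h z : tame V -> [/\ v \in V, h \in V & z \in V] ->
  dg V v <= 1 -> dg V h = 3 -> dg V z <= 2 -> e h v -> e h z -> z != v -> reduces3 3 V.
Proof.
move=> tV [vV hV zV] dv dh dz hv hz zv; exists [:: z; h; v] => //; split=> /=.
- by rewrite !inE negb_or zv eq_sym !adj_neq.
- by rewrite zV hV vV.
- have : dg (del V [:: z; h; v]) z + 1 <= dg V z by apply: (@dg_del2 _ _ _ h); side.
  have : dg (del V [:: z; h; v]) v + 1 <= dg V v by apply: (@dg_del2 _ _ _ h); side.
  have : dg (del V [:: z; h; v]) h + 2 <= dg V h by apply: (@dg_del3 _ _ _ z v); side.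
  lia.
- have := Wle_del1_hub hV (Wle_excess tV); rewrite dh; apply: Wle_subset.
  by apply: del_subset1; rewrite !inE eqxx orbT.
Qed.

Lemma reduces3_3 V : tame V -> 2 < #|V| -> 3 * excess V <= #|V| -> reduces3 3 V.
Proof.
move=> tV cV le; have [h0 noP] := tV.
(* An isolated vertex can be appended last, which leaves a two-vertex deletion to find in the
   rest. *)
case: (boolP [exists v in V, dg V v == 0]) => [/exists_inP[v vV /eqP dv]|/exists_inPn iso].
  have [tV' ex] := tame_isolated tV vV dv.
  have cV' : #|V| = (#|V :\ v|).+1 by rewrite (cardsD1 v) vV.
  have [||s ss rs] := reduces3_2 tV'; rewrite ?ex; [lia | lia |].
  by exists (rcons s v); rewrite ?size_rcons ?ss //; apply: removable_isolated; rewrite ?ss -?ex.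
apply: NNPP => nr.
have [|leaf nf] := irreducible3 tV cV _ nr; first by move=> v /iso; rewrite lt0n.
have hubs_gt0 : 0 < #|hubs V| by apply: exists_hub => //; rewrite -card_gt0; lia.
suff : 2 * #|V| + \sum_(h in V | 2 < dg V h) 1 <= 6 * excess V.
  by rewrite sum_hubs_const; lia.
(* A low vertex sends 2 to a single hub neighbour, or 1 to each of two. *)
apply: (@discharge_slack V (fun v _ => 3 - #|hubnb V v|)) => [v vV dv|h hV dh].
  rewrite sum_nat_const; have := card_hubnb_gt0 dv (nf v vV); have := card_hubnb V v.
  by move: #|_| => [|[|[|?]]]; lia.
have le2 : forall v, v \in lownb V h -> 3 - #|hubnb V v| <= 2.
  move=> v; rewrite !inE => /andP[/andP[vV _] dv].
  by have := card_hubnb_gt0 dv (nf v vV); lia.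
have cl := card_lownb V h.
have [dh4|dh3] := ltnP 3 (dg V h); first by have := sum_lownb_le le2; lia.
have {}dh : dg V h = 3 by lia.
(* A degree-3 hub can receive at most 3. A vertex sending it 2 must be its only low neighbour:
   otherwise there is a leaf to delete with the hub and another low vertex, or a pendant path. *)
case: (boolP [exists v in lownb V h, #|hubnb V v| <= 1]) => [/exists_inP[v vh cv]|/exists_inPn H].
  suff cl1 : #|lownb V h| <= 1 by have := sum_lownb_le le2; lia.
  rewrite leqNgt; apply/negP => /card_gt1P[z [z' [zh z'h zz']]]; apply: nr.
  have [v1|[u [uV vu uh du]]] := one_hubnb cv vh hV (eq_leq (esym dh)).
    have [y yh yv] : exists2 y, y \in lownb V h & y != v.
      by have [zv|zv] := eqVneq z v; [exists z'; rewrite // eq_sym -zv | exists z].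
    move: vh yh; rewrite !inE => /andP[/andP[vV hv] _] /andP[/andP[yV hy] dy].
    exact: (@reduces3_leaf_hub3 V v h y).
  move: vh; rewrite !inE => /andP[/andP[vV hv] dv].
  by have := noP h v u; rewrite /pendant_path hV vV uV hv vu dh dv du.
have le1 : forall v, v \in lownb V h -> 3 - #|hubnb V v| <= 1.
  by move=> v /H; rewrite -ltnNge; lia.
by have := sum_lownb_le le1; lia.
Qed.

(* A hub of degree at least 4 alone accounts for the required drop, and degeneracy
   provides one more vertex. *)
Lemma reduces4_hub V h s : tame V -> h \in V -> 3 < dg V h -> uniq (h :: s) ->
  all [in V] s -> (size s).+1 < #|V| -> dg (del V (h :: s)) h <= 3 ->
  slots (del V (h :: s)) 4 2 s -> reduces4 (size s).+2 V.
Proof.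
move=> tV hV dh us sV cV dh3 sl; have hs : all [in V] (h :: s) by rewrite /= hV.
have [f fD df] := deg2 (del_neq0 us hs cV); have := fD.
rewrite mem_del inE negb_or => /andP[/andP[fh fs] fV].
have hs' : h \notin s by case/andP: us.
have us' : uniq s by case/andP: us.
have sub : del V (h :: f :: s) \subset del V (h :: s).
  by apply: del_subset => y; rewrite !inE => /orP[->|->]; rewrite ?orbT.
exists [:: h, f & s] => //; split=> /=.
- by rewrite inE negb_or eq_sym fh hs' fs us'.
- by rewrite hV fV.
- rewrite addn0 addn1 !ltnS (leq_trans (dg_subset _ sub)) //=.
  by rewrite (leq_trans (dg_subset _ sub)) //= (slots_subset sub).
- apply: (@Wle_subset _ (V :\ h)); first by apply: del_subset1; rewrite mem_head.
  by apply: Wle_leq (Wle_del1_hub hV (Wle_excess tV)); split_lia.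
Qed.

Lemma reduces4_hub5 V h y z : tame V -> [/\ h \in V, y \in V & z \in V] -> dg V h = 5 ->
  y \in lownb V h -> z \in lownb V h -> y != z -> reduces4 3 V.
Proof.
move=> tV [hV yV zV] dh; rewrite !inE => /andP[/andP[_ hy] dy] /andP[/andP[_ hz] dz] yz.
exists [:: h; y; z] => //; split=> /=.
- by rewrite !inE negb_or yz !adj_neq.
- by rewrite hV yV zV.
- have : dg (del V [:: h; y; z]) y + 1 <= dg V y by apply: (@dg_del2 _ _ _ h); side.
  have : dg (del V [:: h; y; z]) z + 1 <= dg V z by apply: (@dg_del2 _ _ _ h); side.
  have : dg (del V [:: h; y; z]) h + 2 <= dg V h by apply: (@dg_del3 _ _ _ y z); side.
  lia.
- apply: (@Wle_subset _ (V :\ h)); first by apply: del_subset1; rewrite mem_head.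
  by apply: Wle_leq (Wle_del1_hub hV (Wle_excess tV)); split_lia.
Qed.

Lemma reduces4_3 V : tame V -> 2 < #|V| -> 2 * excess V <= #|V| + 1 -> reduces4 3 V.
Proof.
move=> tV cV le; apply: NNPP => nr.
have nr2 : ~ reduces3 2 V by move=> r2; apply: nr; apply: reduces_succ r2.
have low := irreducible2 tV (ltnW cV) nr2.
have hub h v : v \in lownb V h -> h \in V -> 4 < dg V h.
  rewrite inE mem_nb => /andP[/andP[vV hv] dv] hV.
  have vh : e v h by rewrite sym.
  have [_ /(_ h)] := low v vV dv; rewrite mem_nb hV vh => /(_ isT) dh.
  rewrite ltn_neqAle dh andbT; apply/eqP => dh4; apply: nr.
  have := @reduces4_hub V h [:: v] tV hV dh; apply=> //=.
  - by rewrite inE adj_neq.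
  - by rewrite vV.
  - have : dg (del V [:: h; v]) h + 1 <= dg V h by apply: (@dg_del2 _ _ _ v); side.
    by rewrite -dh4; lia.
  - have : dg (del V [:: h; v]) v + 1 <= dg V v by apply: (@dg_del2 _ _ _ h); side.
    lia.
have V0 : V != set0 by rewrite -card_gt0; lia.
(* The final count reads [2 * #|V| + 2 * #|hubs V| <= 2 * #|V| + 2], so two hubs are needed; the two
   neighbours of a low vertex provide them. *)
have hubs_gt1 : 1 < #|hubs V|.
  have [v vV dv] := deg2 V0; have [d2 hv] := low v vV dv.
  rewrite -d2; apply: subset_leq_card; apply/subsetP => h hn.
  by rewrite inE ltnW ?hv // andbT; move: hn; rewrite mem_nb => /andP[].
suff : 2 * #|V| + \sum_(h in V | 2 < dg V h) 2 <= 4 * excess V.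
  by rewrite sum_hubs_const; lia.
apply: (@discharge_slack V (fun _ _ => 1)) => [v vV dv|h hV dh].
  have [d2 hv] := low v vV dv; rewrite sum1_card -[X in X <= _]d2.
  by apply: subset_leq_card; apply/subsetP => h hn; rewrite inE hn ltnW ?hv.
rewrite sum1_card; have [E|[v vh]] := set_0Vmem (lownb V h).
  by rewrite E cards0; lia.
have dh5 := hub h v vh hV; have := card_lownb V h.
have [dh6|dh5'] := ltnP 5 (dg V h); first by lia.
suff : #|lownb V h| <= 1 by lia.
rewrite leqNgt; apply/negP => /card_gt1P[y [z [yh zh yz]]]; apply: nr.
apply: (@reduces4_hub5 V h y z) => //; last by apply/eqP; rewrite eqn_leq dh5'.
by move: yh zh; rewrite !inE hV => /andP[/andP[-> _] _] /andP[/andP[-> _] _].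
Qed.

(** * Four deleted vertices for k = 4 *)

Lemma reduces3_leaf_leaf V u v h : tame V -> [/\ u \in V, v \in V & h \in V] -> u != v ->
  dg V u <= 1 -> dg V v <= 1 -> dg V h = 3 -> e h u -> reduces3 3 V.
Proof.
move=> tV [uV vV hV] uv du dv dh hu; exists [:: h; v; u] => //; split=> /=.
- by rewrite !inE negb_or (adj_neq hu) [h == v]eq_sym (@dg_neq V v h 1) ?dh // eq_sym uv.
- by rewrite uV hV vV.
- have : dg (del V [:: h; v; u]) h + 1 <= dg V h by apply: (@dg_del2 _ _ _ u); side.
  have : dg (del V [:: h; v; u]) u + 1 <= dg V u by apply: (@dg_del2 _ _ _ h); side.
  have := dg_del0 V [:: h; v; u] v; split_lia.
- have := Wle_del1_hub hV (Wle_excess tV); rewrite dh; apply: Wle_subset.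
  by apply: del_subset1; rewrite mem_head.
Qed.

Lemma reduces4_leaf_hub V v h z : tame V -> 3 < #|V| -> [/\ v \in V, h \in V & z \in V] ->
  dg V v <= 1 -> 2 < dg V h <= 5 -> dg V z <= 2 -> e h v -> e h z -> z != v -> reduces4 4 V.
Proof.
move=> tV cV [vV hV zV] dv /andP[dh3 dh5] dz hv hz zv.
have [dh|dh] := leqP (dg V h) 3.
  apply: reduces_succ => //; apply: (@reduces3_leaf_hub3 V v h z) => //; split_lia.
apply: (@reduces4_hub V h [:: z; v]) => //=.
- by rewrite !inE negb_or zv !adj_neq.
- by rewrite zV vV.
- have : dg (del V [:: h; z; v]) h + 2 <= dg V h by apply: (@dg_del3 _ _ _ z v); side.
  split_lia.
- have : dg (del V [:: h; z; v]) z + 1 <= dg V z by apply: (@dg_del2 _ _ _ h); side.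
  have : dg (del V [:: h; z; v]) v + 1 <= dg V v by apply: (@dg_del2 _ _ _ h); side.
  split_lia.
Qed.

Lemma reduces4_low_low_hub4 V x y h : tame V -> 3 < #|V| -> [/\ x \in V, y \in V & h \in V] ->
  e x y -> e x h -> dg V x <= 2 -> dg V y <= 2 -> dg V h = 4 -> reduces4 4 V.
Proof.
move=> tV cV [xV yV hV] xy xh dx dy dh.
have hy : h != y by rewrite eq_sym (@dg_neq V _ _ 2) ?dh.
apply: (@reduces4_hub V h [:: y; x]) => //=.
- by rewrite dh.
- by rewrite !inE negb_or hy [h == x]eq_sym [y == x]eq_sym !adj_neq.
- by rewrite xV yV.
- have : dg (del V [:: h; y; x]) h + 1 <= dg V h by apply: (@dg_del2 _ _ _ x); side.
  split_lia.
- have : dg (del V [:: h; y; x]) y + 1 <= dg V y by apply: (@dg_del2 _ _ _ x); side.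
  have : dg (del V [:: h; y; x]) x + 2 <= dg V x by apply: (@dg_del3 _ _ _ h y); side.
  split_lia.
Qed.

Lemma reduces4_low_low_hub5 V x y z h : tame V -> 3 < #|V| ->
  [/\ x \in V, y \in V, z \in V & h \in V] -> e x y -> e x h -> e z h -> z != x ->
  dg V x <= 2 -> dg V y <= 2 -> dg V z <= 2 -> dg V h = 5 -> reduces4 4 V.
Proof.
move=> tV cV [xV yV zV hV] xy xh zh zx dx dy dz dh.
have hy : h != y by rewrite eq_sym (@dg_neq V _ _ 2) ?dh.
have hx : h != x by rewrite eq_sym adj_neq.
have hz : h != z by rewrite eq_sym adj_neq.
have yx : y != x by rewrite eq_sym adj_neq.
(* A hub of degree 5 must lose two neighbours to come first. If [z] is [y], the triangle suffices
   and [reduces4_hub] supplies the fourth vertex. *)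
have [zy|zy] := eqVneq z y.
  apply: (@reduces4_hub V h [:: y; x]) => //=; rewrite ?dh ?xV ?yV //.
  - by rewrite !inE negb_or hx hy yx.
  - have : dg (del V [:: h; y; x]) h + 2 <= dg V h.
      by apply: (@dg_del3 _ _ _ x y); try side; rewrite sym -zy.
    split_lia.
  - have : dg (del V [:: h; y; x]) y + 1 <= dg V y by apply: (@dg_del2 _ _ _ x); side.
    have : dg (del V [:: h; y; x]) x + 2 <= dg V x by apply: (@dg_del3 _ _ _ h y); side.
    split_lia.
exists [:: h; z; y; x] => //; split=> /=.
- by rewrite !inE !negb_or hx hy hz zy zx yx.
- by rewrite hV xV yV zV.
- have : dg (del V [:: h; z; y; x]) h + 2 <= dg V h by apply: (@dg_del3 _ _ _ x z); side.
  have : dg (del V [:: h; z; y; x]) z + 1 <= dg V z by apply: (@dg_del2 _ _ _ h); side.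
  have : dg (del V [:: h; z; y; x]) y + 1 <= dg V y by apply: (@dg_del2 _ _ _ x); side.
  have : dg (del V [:: h; z; y; x]) x + 2 <= dg V x by apply: (@dg_del3 _ _ _ h y); side.
  split_lia.
- apply: (@Wle_subset _ (V :\ h)); first by apply: del_subset1; rewrite mem_head.
  by apply: Wle_leq (Wle_del1_hub hV (Wle_excess tV)); split_lia.
Qed.

(** Both [a] and [b] lose a unit of excess, and [b] need not be hit: a new cycle component through
    [b] would contain [x], which keeps at most one neighbour. *)
Lemma Wle_del1_triangle V x a b : tame V -> [/\ x \in V, a \in V & b \in V] ->
  e x a -> e x b -> e a b -> dg V x <= 2 -> dg V a = 3 -> dg V b = 3 ->
  Wle (V :\ a) (excess V - 2).
Proof.
move=> [h0 _] [xV aV bV] xa xb ab dx da db.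
pose Y := [set y in nb V a | 2 < dg V y].
exists (set0 :\ a :|: (Y :\ b)); last first.
  have := excess_del1 aV.
  rewrite set0D set0U -/Y (cardsD1 b Y) !inE bV ab db da /=; split_lia.
apply: hits_del1 h0 _ => // A cA y yA ya.
exists y => //; rewrite !inE (cyc_del1_dg aV cA yA ya) andbT; move: (ya); rewrite mem_nb => ->.
rewrite andbT; apply/eqP => yb; have [_ _ Ad] := cA.
have [_ /subsetP nB] := Ad y yA.
have xA : x \in A by apply: nB; rewrite yb !inE xV sym xb adj_neq.
by have [d _] := Ad x xA; move: dx; rewrite (dg_del1 x aV) d xa.
Qed.

(* Deleting the two hubs and their common low neighbour x, together with one further low
   neighbour z of one of them. *)
Lemma reduces4_two_hubs V x a b z : tame V -> [/\ x \in V, a \in V, b \in V & z \in V] ->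
  e x a -> e x b -> a != b -> dg V x <= 2 -> dg V a = 3 -> 2 < dg V b -> dg V z <= 2 ->
  z != x -> (e z b && (dg V b <= 5)) || (e z a && (dg V b <= 4)) -> reduces4 4 V.
Proof.
move=> tV [xV aV bV zV] xa xb ab dx da db dz zx zab.
have az : a != z by rewrite eq_sym (@dg_neq V _ _ 2) ?da.
have bz : b != z by rewrite eq_sym (@dg_neq V _ _ 2).
have ax : a != x by rewrite eq_sym adj_neq.
have bx : b != x by rewrite eq_sym adj_neq.
exists [:: b; a; z; x] => //; split=> /=.
- by rewrite !inE !negb_or az bz ax bx eq_sym ab zx.
- by rewrite aV xV bV zV.
- have : dg (del V [:: b; a; z; x]) x + 2 <= dg V x by apply: (@dg_del3 _ _ _ a b); side.
  have : dg (del V [:: b; a; z; x]) a + 1 <= dg V a by apply: (@dg_del2 _ _ _ x); side.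
  case/orP: zab => /andP[zh dh].
    have : dg (del V [:: b; a; z; x]) b + 2 <= dg V b by apply: (@dg_del3 _ _ _ x z); side.
    have : dg (del V [:: b; a; z; x]) z + 1 <= dg V z by apply: (@dg_del2 _ _ _ b); side.
    split_lia.
  have : dg (del V [:: b; a; z; x]) b + 1 <= dg V b by apply: (@dg_del2 _ _ _ x); side.
  have : dg (del V [:: b; a; z; x]) z + 1 <= dg V z by apply: (@dg_del2 _ _ _ a); side.
  split_lia.
have WV := Wle_excess tV.
(* The drop by 2 comes from [b] alone if its degree is at least 4, from the triangle if [a] and [b]
   are adjacent of degree 3, and otherwise from one unit for each of them. *)
have [db4|db3] := ltnP 3 (dg V b).
  apply: (@Wle_subset _ (V :\ b)); first by apply: del_subset1; rewrite mem_head.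
  by apply: Wle_leq (Wle_del1_hub bV WV); split_lia.
have {}db : dg V b = 3 by split_lia.
case: (boolP (e a b)) => eab.
  apply: (@Wle_subset _ (V :\ a)); first by apply: del_subset1; rewrite !inE eqxx orbT.
  exact: (@Wle_del1_triangle V x a b).
apply: (@Wle_subset _ (V :\ a :\ b)).
  by apply/subsetP => y; rewrite !inE !negb_or => /andP[/and4P[-> -> _ _] ->].
have bVa : b \in V :\ a by rewrite !inE eq_sym ab.
apply: Wle_leq (Wle_del1_hub bVa (Wle_del1_hub aV WV)).
by have := dg_del1 b aV; rewrite sym (negPf eab) da db addn0 => <-; split_lia.
Qed.

(* The charge (out of 2) that a vertex v of degree at most 2 sends to its hub neighbour h;
   between a hub of degree 3 and one of degree at least 5 all of it goes to the latter. *)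
Definition charge V v h :=
  if #|hubnb V v| <= 1 then 2 else
  if (dg V h == 3) && [exists g in hubnb V v :\ h, 4 < dg V g] then 0 else
  if (4 < dg V h) && [exists g in hubnb V v :\ h, dg V g == 3] then 2 else 1.

Lemma charge_le2 V v h : charge V v h <= 2.
Proof. by rewrite /charge; do !case: ifP. Qed.

Lemma exists_setD1_pair a b (P : pred T) : a != b ->
  [exists g in [set a; b] :\ a, P g] = P b.
Proof.
move=> ab; apply/exists_inP/idP => [[g]|Pb].
  by rewrite !inE => /andP[/negPf-> /= /eqP->].
by exists b; rewrite // !inE eq_sym ab eqxx orbT.
Qed.

Lemma sum_charge V v : dg V v <= 2 -> ~~ hub_free V v ->
  2 <= \sum_(h in hubnb V v) charge V v h.
Proof.
move=> dv nf; have c0 := card_hubnb_gt0 dv nf; have c2 := leq_trans (card_hubnb V v) dv.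
have [c1|c1] := leqP #|hubnb V v| 1.
  rewrite (eq_bigr (fun _ => 2)) => [|h _]; first by rewrite sum_nat_const; lia.
  by rewrite /charge c1.
have cE : #|hubnb V v| == 2 by rewrite eqn_leq c2.
have hub g : g \in hubnb V v -> 2 < dg V g by rewrite inE => /andP[].
have /cards2P[a [b [ab E]]] := cE.
have da : 2 < dg V a by apply: hub; rewrite E !inE eqxx.
have db : 2 < dg V b by apply: hub; rewrite E !inE eqxx orbT.
rewrite /charge (eqP cE) /= E big_setU1 ?inE //= big_set1 exists_setD1_pair //.
rewrite exists_setD1_pair // setUC exists_setD1_pair 1?eq_sym //.
rewrite exists_setD1_pair 1?eq_sym //.
move: (dg V a) (dg V b) da db => p r hp hr.
by case: ltngtP hp => //; case: ltngtP hr => //; do !case: ifP; lia.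
Qed.

(** A second low neighbour [z] makes every larger charge reducible: a vertex with one hub neighbour
    is a leaf or has a low neighbour, and a vertex with two hub neighbours falls under
    [reduces4_two_hubs] unless the rule already gives the smaller charge. *)
Lemma charge_le1 V v h z : tame V -> 3 < #|V| -> ~ reduces4 4 V -> h \in V ->
  2 < dg V h <= 5 -> v \in lownb V h -> z \in lownb V h -> z != v ->
  charge V v h <= (3 < dg V h).
Proof.
move=> tV cV nr hV dh vh zh zv; have [_ noP] := tV; have [dh3 dh5] := andP dh.
have := zh; rewrite inE mem_nb => /andP[/andP[zV hz] dz].
have := vh; rewrite inE mem_nb => /andP[/andP[vV hv] dv].
have vhs : e v h by rewrite sym.
have zhs : e z h by rewrite sym.
rewrite /charge; have [c1|c1] := leqP #|hubnb V v| 1.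
  case: (one_hubnb c1 vh hV dh3) => [v1|[u [uV vu uh du]]].
    by case: nr; apply: (@reduces4_leaf_hub V v h z).
  have [dh4|dh4|dh4] := ltngtP 4 (dg V h).
  - case: nr; apply: (@reduces4_low_low_hub5 V v u z h) => //.
    by apply/eqP; rewrite eqn_leq dh5.
  - have := noP h v u; rewrite /pendant_path hV vV uV hv vu dv du /= !andbT.
    by rewrite eqn_leq dh3 -ltnS dh4.
  - by case: nr; apply: (@reduces4_low_low_hub4 V v u h).
have [g] : exists g, g \in hubnb V v :\ h.
  by apply/set0Pn; rewrite -card_gt0; have := cardsD1 h (hubnb V v); case: (h \in _); split_lia.
rewrite !inE => /andP[gh /andP[/andP[gV vg] dg3]].
have [dh34|dh34] := leqP (dg V h) 3.
  have dhE : dg V h = 3 by apply/eqP; rewrite eqn_leq dh34.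
  rewrite dhE /=; case: exists_inP => // ng; case: nr.
  apply: (@reduces4_two_hubs V v h g z) => //; first by rewrite eq_sym.
  rewrite zhs andTb orbC leqNgt; apply/orP; left; apply/negP => g5; case: ng; exists g => //.
  by rewrite !inE gh gV vg.
do 2!case: ifP => //; move=> /andP[dh4 /exists_inP[g' + /eqP dg']] _.
rewrite !inE => /andP[g'h /andP[/andP[g'V vg'] _]]; case: nr.
by apply: (@reduces4_two_hubs V v g' h z); rewrite ?zhs ?dh5.
Qed.

Lemma reduces4_4 V : tame V -> 3 < #|V| -> 2 * excess V <= #|V| -> reduces4 4 V.
Proof.
move=> tV cV le; have [h0 noP] := tV.
case: (boolP [exists v in V, dg V v == 0]) => [/exists_inP[v vV /eqP dv]|/exists_inPn iso].
  have [tV' ex] := tame_isolated tV vV dv.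
  have cV' : #|V| = (#|V :\ v|).+1 by rewrite (cardsD1 v) vV.
  have [||s ss rs] := reduces4_3 tV'; rewrite ?ex; [lia | lia |].
  by exists (rcons s v); rewrite ?size_rcons ?ss //; apply: removable_isolated; rewrite ?ss -?ex.
apply: NNPP => nr.
have nr3 : ~ reduces3 3 V by move=> r3; apply: nr; apply: reduces_succ r3.
have [|leaf nf] := irreducible3 tV (ltnW cV) _ nr3; first by move=> v /iso; rewrite lt0n.
(* Such a hub may have no spare capacity: its own 2 and the 2 from a leaf exhaust the 4
   available. *)
pose tight h := (dg V h == 3) && [exists v in lownb V h, dg V v <= 1].
have hubs_gt0 : 0 < #|hubs V| by apply: exists_hub => //; rewrite -card_gt0; lia.
(* The count needs one unit of slack. A tight hub has another neighbour, which must be a hub; were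
   it tight too, two distinct leaves would be reducible by [reduces3_leaf_leaf]. *)
have [g [gV dg3 ng]] : exists g, [/\ g \in V, 2 < dg V g & ~~ tight g].
  move/card_gt0P: hubs_gt0 => [h]; rewrite inE => /andP[hV dh].
  case: (boolP (tight h)) => [|nh]; last by exists h.
  case/andP=> /eqP dhE /exists_inP[u]; rewrite inE mem_nb => /andP[/andP[uV hu] du] u1.
  have [|y [yV hy yu]] := nb2P uV hu; first by rewrite dhE.
  exists y; split=> //.
    rewrite ltnNge; apply/negP => dy; apply: nr.
    by apply: (@reduces4_leaf_hub V u h y); rewrite ?dhE.
  apply/negP => /andP[/eqP dyE /exists_inP[v]].
  rewrite inE mem_nb => /andP[/andP[vV yv] dv] v1; apply: nr3.
  apply: (@reduces3_leaf_leaf V u v h) => //; apply: contraTneq u1 => uv.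
  rewrite -ltnNge; apply/card_gt1P; exists h, y.
  by rewrite !mem_nb hV yV ![e u _]sym hu uv yv adj_neq.
suff : 2 * #|V| + \sum_(h in V | 2 < dg V h) ~~ tight h <= 4 * excess V.
  by rewrite (bigD1 g) /= ?gV // ng; lia.
apply: (@discharge_slack V (charge V)) => [v vV dv|h hV dh]; first exact: sum_charge dv (nf v vV).
have cl := card_lownb V h.
have [dh6|dh5] := ltnP 5 (dg V h).
  have := @sum_lownb_le V h 2 (fun v => charge V v h) (fun v _ => charge_le2 V v h); lia.
have [c1|c2] := leqP #|lownb V h| 1.
  have := @sum_lownb_le V h 2 (fun v => charge V v h) (fun v _ => charge_le2 V v h).
  have [dh4|dh3] := ltnP 3 (dg V h); first by lia.
  have dhE : dg V h = 3 by apply/eqP; rewrite eqn_leq dh3.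
  case: (boolP (tight h)) => [_|]; first by lia.
  rewrite /tight dhE /= => /exists_inPn nl _.
  suff /sum_lownb_le : forall v, v \in lownb V h -> charge V v h <= 1 by lia.
  move=> v vh; rewrite /charge dhE /=; have [cv|_] := leqP #|hubnb V v| 1; last by case: ifP.
  case: (one_hubnb cv vh hV dh) => [v1|[u [uV vu uh du]]]; first by have := nl v vh; rewrite v1.
  move: vh; rewrite inE mem_nb => /andP[/andP[vV hv] dv].
  by have := noP h v u; rewrite /pendant_path hV vV uV hv vu dv du dhE.
have /sum_lownb_le : forall v, v \in lownb V h -> charge V v h <= (3 < dg V h).
  move=> v vh; have [z zh zv] : exists2 z, z \in lownb V h & z != v.
    have /card_gt1P[z [z' [zh z'h zz']]] := c2.
    by have [zv|zv] := eqVneq z v; [exists z'; rewrite // eq_sym -zv | exists z].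
  by apply: (@charge_le1 V v h z); rewrite ?dh.
by case: (ltnP 3 (dg V h)) => /=; lia.
Qed.

(** * The induction on the number of vertices *)

Lemma removable_colorable k L V s w : list_assignment k L -> 0 < size s <= k ->
  size s = k \/ k %| #|V| - size s -> removable k V s w -> colorable k L (del V s) ->
  colorable k L V.
Proof.
by move=> kL sk sd [us /allP sV sl _]; apply: colorable_del sl.
Qed.

Lemma colorable_small k L V : list_assignment k L -> #|V| <= k -> colorable k L V.
Proof.
move=> kL cV; have [V0|V0] := posnP #|V|.
  exists (fun _ => 0); have {}V0 : V = set0 by apply/eqP; rewrite -cards_eq0 V0.
  split=> [v|u v|q m /andP[m0 _]]; rewrite V0 ?inE // cards0 => /esym/eqP.
  by rewrite addn_eq0 andbC eqn0Ngt m0.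
have D : del V (enum V) = set0.
  by apply/setP => x; rewrite !inE mem_enum andNb.
apply: (@colorable_del k L V (enum V)) => //; rewrite ?enum_uniq -?cardE ?V0 ?subnn ?dvdn0 //.
- by move=> x; rewrite mem_enum.
- by right.
- rewrite D; have : 0 + size (enum V) <= k by rewrite -cardE.
  have dg0 x : dg set0 x = 0 by apply/eqP; rewrite cards_eq0; apply/eqP/setP => y; rewrite !inE.
  elim: (enum V) 0 => //= x s IH i; rewrite dg0 => le.
  by rewrite IH ?addSnnS // andbT; lia.
rewrite D; exists (fun _ => 0); split=> [v|u v|q m /andP[m0 _]]; rewrite ?inE // cards0 => /esym/eqP.
by rewrite addn_eq0 andbC eqn0Ngt m0.
Qed.

Lemma tame_or_pendant V : hits V set0 ->
  tame V \/ exists y z z', pendant_path V y z z'.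
Proof.
move=> h0; case: (boolP [exists y, [exists z, [exists z', pendant_path V y z z']]]).
  by move=> /existsP[y /existsP[z /existsP[z' P]]]; right; exists y, z, z'.
move=> /existsPn noP; left; split=> // y z z'.
by have /existsPn/(_ z)/existsPn := noP y.
Qed.

Lemma removable_card k V s w : removable k V s w -> #|V| = #|del V s| + size s.
Proof. by case=> us /allP sV _ _; apply: card_del. Qed.

(** The bound says that [w] is at most the ceiling of n/3. It survives deleting three vertices, or
    the residual ones, at the price of one unit. *)
Lemma reduction3 V w : 3 < #|V| -> Wle V w -> 3 * w <= #|V| + 2 ->
  exists s, [/\ 0 < size s <= 3, size s = 3 \/ 3 %| #|V| - size s & removable 3 V s (w - 1)].
Proof.
move=> cV WV le; case: (Wle_cases WV) => [[h0 ew]|[A [v [cA vA Wv]]]]; last first.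
  by have [s ss rs] := removable_cyc cA vA Wv; exists s; rewrite ss; split=> //; left.
have wk s : removable 3 V s (excess V - 1) -> removable 3 V s (w - 1).
  by case=> *; split=> //; apply: Wle_leq (leq_sub2r 1 ew) _.
case: (tame_or_pendant h0) => [tV|[y [z [z' P]]]]; last first.
  by have [s ss /wk rs] := reduces3_path h0 P; exists s; rewrite ss; split=> //; left.
have V0 : V != set0 by rewrite -card_gt0; lia.
have n3 := divn_eq #|V| 3; have := ltn_pmod #|V| (isT : 0 < 3).
have d3 j : j = #|V| %% 3 -> 3 %| #|V| - j.
  by move=> ->; rewrite {1}n3 addnK dvdn_mull.
(* By integrality the bound sharpens to [3 * w <= #|V|] for residue 0 and [3 * w <= #|V| + 1] for
   residue 2, as the discharging lemmas require. *)
case E : (#|V| %% 3) => [|[|[|//]]] _.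
- have [||s ss /wk rs] := @reduces3_3 V tV; [lia | lia |].
  by exists s; rewrite ss; split=> //; left.
- have [x [xV dx Wx]] := strict_low tV V0.
  exists [:: x]; split=> //=; first by right; apply: d3.
  apply: wk; split; rewrite //= ?xV // ?andbT ?addn0.
    by rewrite ltnS (leq_trans (dg_del0 _ _ _)).
  by apply: Wle_subset Wx; apply: del_subset1; rewrite mem_head.
- have [||s ss /wk rs] := @reduces3_2 V tV; [lia | lia |].
  by exists s; rewrite ss; split=> //; right; apply: d3.
Qed.

Lemma colorable3 L V w : list_assignment 3 L -> Wle V w -> 3 * w <= #|V| + 2 ->
  colorable 3 L V.
Proof.
move=> kL; have [n] := ubnP #|V|; elim: n V w => // n IH V w Vn WV le.
have [cV|cV] := leqP #|V| 3; first exact: colorable_small.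
have [s [sk sd rs]] := reduction3 cV WV le; have cD := removable_card rs.
apply: (removable_colorable kL sk sd rs); have [_ _ _ Ws] := rs.
have [s0 s3] := andP sk; apply: (IH _ _ _ Ws); first by lia.
case: sd => [sE|/dvdnP[q]]; first by lia.
by rewrite cD addnK => qE; lia.
Qed.

(* Removing four vertices lowers the potential by 2, and the single removal of the
   n mod* 4 residual ones by at most 2. *)
Definition bound4 n := (n.-1 %/ 4).*2 + minn 2 (n.-1 %% 4).+1.

Lemma bound4E q m : 0 < m <= 4 -> bound4 (4 * q + m) = 2 * q + minn 2 m.
Proof.
case: m => // m /andP[_ m4]; rewrite /bound4 addnS /= mulnC divnMDl // modnMDl.
by rewrite divn_small // modn_small // addn0 -mul2n.
Qed.

Lemma reduction4 V w : 4 < #|V| -> Wle V w -> w <= bound4 #|V| ->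
  exists s w', [/\ 0 < size s <= 4, size s = 4 \/ 4 %| #|V| - size s,
    removable 4 V s w' & w' <= bound4 #|del V s|].
Proof.
move=> cV WV.
have V0 : V != set0 by rewrite -card_gt0; lia.
have [q [m [m0 m4 qm]]] : exists q m, [/\ 0 < m, m <= 4 & #|V| = 4 * q.+1 + m].
  exists (#|V|.-1 %/ 4).-1, (#|V|.-1 %% 4).+1; rewrite ltn_pmod //; split=> //.
  have := divn_eq #|V|.-1 4; have : 0 < #|V|.-1 %/ 4 by rewrite divn_gt0 //; lia.
  lia.
rewrite qm bound4E ?m0 // => le.
have drop4 s : size s = 4 -> removable 4 V s (w - 2) ->
    exists s w', [/\ 0 < size s <= 4, size s = 4 \/ 4 %| 4 * q.+1 + m - size s,
    removable 4 V s w' & w' <= bound4 #|del V s|].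
  move=> ss rs; exists s, (w - 2); rewrite ss; split=> //; first by left.
  have := removable_card rs; rewrite qm ss => E.
  have -> : #|del V s| = 4 * q + m by lia.
  by rewrite bound4E ?m0 //; lia.
(* Here the rest has [4 * q + 4] vertices: its residue is 4, and [bound4] gives [2 * q + 2]. *)
have dropm s : size s = m -> removable 4 V s (w - minn 2 m) ->
    exists s w', [/\ 0 < size s <= 4, size s = 4 \/ 4 %| 4 * q.+1 + m - size s,
    removable 4 V s w' & w' <= bound4 #|del V s|].
  move=> ss rs; exists s, (w - minn 2 m); rewrite ss m0 addnK dvdn_mulr //.
  split=> //; first by right.
  have := removable_card rs; rewrite qm ss => /addIn E.
  have -> : #|del V s| = 4 * q + 4 by lia.
  by rewrite bound4E //; lia.
(* For residue 1 a single unit is enough, and a vertex of degree 3 may be deleted. *)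
have [m1|m1] := eqVneq m 1.
  have [x [xV dx Wx]] := Wle_del1_deg3 deg2 V0 WV.
  apply: (dropm [:: x]); rewrite ?m1 //; split; rewrite //= ?xV // ?andbT ?addn0.
    by rewrite ltnS (leq_trans (dg_del0 _ _ _)).
  by apply: Wle_subset Wx; apply: del_subset1; rewrite mem_head.
have mE : minn 2 m = 2 by lia.
rewrite mE in le dropm.
have ext s : size s = 3 -> removable 3 V s (w - 1) -> exists2 s', size s' = 4 & removable 4 V s' (w - 2).
  move=> ss rs; have [|x rx] := removable_succ _ rs; first by lia.
  by exists (x :: s); rewrite /= ?ss //; rewrite -subnDA in rx.
case: (Wle_cases WV) => [[h0 ew]|[A [v [cA vA Wv]]]]; last first.
  by have [s ss /(ext _ ss)[s' ss' rs']] := removable_cyc cA vA Wv; apply: (drop4 s').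
have wk k s d : removable k V s (excess V - d) -> removable k V s (w - d).
  by case=> *; split=> //; apply: Wle_leq (leq_sub2r d ew) _.
case: (tame_or_pendant h0) => [tV|[y [z [z' P]]]]; last first.
  have [s ss /wk/(ext _ ss)[s' ss' rs']] := reduces3_path h0 P; exact: (drop4 s').
have [m2|m2] := eqVneq m 2.
  have [x [xV dx Wx]] := strict_low tV V0.
  have r1 : removable 3 V [:: x] (excess V - 1).
    split; rewrite //= ?xV // ?andbT ?addn0.
      by rewrite ltnS (leq_trans (dg_del0 _ _ _)).
    by apply: Wle_subset Wx; apply: del_subset1; rewrite mem_head.
  have [|y] := removable_succ _ r1; first by rewrite /=; lia.
  by rewrite -subnDA => /wk; apply: dropm; rewrite m2.
have [m3|m3] := eqVneq m 3.
  have [||s ss /wk rs] := @reduces4_3 V tV; [lia | lia |].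
  by apply: (dropm s); rewrite ?m3.
have [||s ss /wk rs] := @reduces4_4 V tV; [lia | lia |].
exact: (drop4 s).
Qed.

Lemma colorable4 L V w : list_assignment 4 L -> Wle V w -> w <= bound4 #|V| ->
  colorable 4 L V.
Proof.
move=> kL; have [n] := ubnP #|V|; elim: n V w => // n IH V w Vn WV le.
have [cV|cV] := leqP #|V| 4; first exact: colorable_small.
have [s [w' [sk sd rs le']]] := reduction4 cV WV le; have cD := removable_card rs.
apply: (removable_colorable kL sk sd rs); have [_ _ _ Ws] := rs.
have [s0 _] := andP sk; by apply: (IH _ _ _ Ws) => //; lia.
Qed.

End Graph.

(** * The initial bound on the potential from sparsity *)

Section Sparse.
Variables (T : finType) (e : rel T).
Hypotheses (sym : symmetric e) (irr : irreflexive e).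
Implicit Types (U A B C : {set T}).

(** Double counting of the pairs of a vertex and an edge, as a two-element set, containing it. *)
Lemma handshake A : \sum_(x in A) dg e A x = 2 * induced_edges e A.
Proof.
rewrite /induced_edges; set Es := [set E : {set T} | _].
have EsP E : reflect (exists x y, [/\ x \in A, y \in A, e x y & E = [set x; y]]) (E \in Es).
  rewrite inE; apply: (iffP exists_inP) => [[x xA /exists_inP[y yA /andP[xy /eqP->]]]|].
    by exists x, y.
  by case=> x [y [xA yA xy ->]]; exists x => //; apply/exists_inP; exists y; rewrite ?xy ?eqxx.
transitivity (\sum_(x in A) \sum_(E in Es | x \in E) 1).
  apply: eq_bigr => x xA; rewrite sum1dep_card /dg.
  have -> : [set E in Es | x \in E] = [set [set x; y] | y in nb e A x].
    apply/setP => E; rewrite inE; apply/andP/imsetP => [[EE]|[y]].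
      have [a [b [aA bA ab ->]]] := elimT (EsP E) EE.
      rewrite !inE => /orP[/eqP->|/eqP->]; first by exists b; rewrite // inE bA.
      by exists a; rewrite 1?setUC // inE aA sym.
    rewrite inE => /andP[yA xy] ->; split; last by rewrite !inE eqxx.
    by apply/EsP; exists x, y.
  rewrite card_in_imset // => y z; rewrite !inE => /andP[_ xy] _ E.
  have : y \in [set x; z] by rewrite -E !inE eqxx orbT.
  by rewrite !inE => /orP[/eqP yx|/eqP//]; rewrite yx irr in xy.
rewrite (exchange_big_dep (mem Es)) /=; last by move=> x E _ /andP[].
rewrite mulnC -sum_nat_const.
apply: eq_bigr => E EE; have [a [b [aA bA ab Eab]]] := elimT (EsP E) EE.
have <- : #|[set a; b]| = 2 by rewrite cards2; case: eqP ab => // ->; rewrite irr.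
rewrite sum1dep_card; apply: eq_card => x; rewrite in_set EE Eab in_set2 /=.
by apply: andb_idl => /orP[/eqP->|/eqP->].
Qed.

(** Sparsity keeps the average degree below 3 except on very small sets, where no degree can exceed
    2 anyway. *)
Lemma degenerate2_sparse :
  (forall A, A != set0 -> 2 * induced_edges e A < 3 * #|A| \/ #|A| <= 2) -> degenerate2 e.
Proof.
move=> sparse A A0; apply: NNPP => no; have d3 v : v \in A -> 2 < dg e A v.
  by move=> vA; rewrite ltnNge; apply/negP => dv; apply: no; exists v.
case: (sparse A A0) => [|c2].
  rewrite -handshake ltnNge mulnC -sum_nat_const => /negP[]; exact: leq_sum.
have [v vA] := set0Pn _ A0; have := d3 v vA; rewrite ltnNge => /negP[]; apply: leq_trans c2.
by apply: subset_leq_card; apply/subsetP => y; rewrite inE => /andP[].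
Qed.

Definition adj_closed A := {in A, forall x y, e x y -> y \in A}.

Lemma nb_closed A x : adj_closed A -> x \in A -> nb e A x = nb e setT x.
Proof.
move=> cA xA; apply/setP => y; rewrite !inE; apply: andb_idl; exact: cA.
Qed.

(** [cyc] admits unions; a minimal one is a single cycle component, so one vertex of it hits every
    [cyc] set that meets it. *)
Lemma cyc_minimal U B : cyc e U B ->
  exists2 C, cyc e U C & forall C', cyc e U C' -> C' \subset C -> C' = C.
Proof.
have [n] := ubnP #|B|; elim: n B => // n IH B Bn cB.
have [[C [cC CB]]|no] := classic (exists C, cyc e U C /\ C \proper B).
  by apply: IH cC; have := proper_card CB; lia.
exists B => // C cC CB; apply/eqP; rewrite eqEsubset CB; apply: contraT => nBC.
by case: no; exists C; rewrite properE CB.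
Qed.

(* Peeling off a whole cycle component costs three vertices and one unit of [Wle]. *)
Lemma Wle_core U : adj_closed U -> exists A c,
  [/\ adj_closed A, #|A| + 3 * c <= #|U| & Wle e U (excess e A + c)].
Proof.
have [n] := ubnP #|U|; elim: n U => // n IH U Un cU.
have [h0|h] := classic (hits e U set0).
  by exists U, 0; rewrite muln0 addn0; split=> //; exists set0; rewrite // cards0 addn0.
have {h}[B0 h] := not_all_ex_not _ _ h; have {h}[/cyc_minimal[B cB minB] _] := imply_to_and _ _ h.
have [B0' /subsetP BU Bd] := cB; have [v vB] := set0Pn _ B0'; have [dv nv] := Bd v vB.
have Bc x y : x \in B -> y \in U -> e x y -> y \in B.
  by move=> xB yU xy; have [_ /subsetP] := Bd x xB; apply; rewrite inE yU.
(* The set contains [v] and its two neighbours. *)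
have c3 : 2 < #|B|.
  have := subset_leq_card nv; rewrite -/(dg e U v) dv (cardsD1 v B) vB => c2.
  rewrite ltnS -dv; apply: subset_leq_card; apply/subsetP => y yn.
  rewrite in_setD1 (subsetP nv) // andbT; apply: contraTneq yn => ->.
  by rewrite inE irr andbF.
have cUB : adj_closed (U :\: B).
  move=> x; rewrite inE => /andP[xB xU] y xy; rewrite inE (cU x xU y xy) andbT.
  by apply: contra xB => yB; apply: (Bc y x); rewrite // sym.
have cardU : #|U| = #|U :\: B| + #|B|.
  by rewrite -(cardsID B) addnC (setIidPr _) //; apply/subsetP.
have [|A [c [cA Ac [X hX le]]]] := IH _ _ cUB; first by lia.
have nbE x : x \in U -> x \notin B -> nb e (U :\: B) x = nb e U x.
  by move=> xU xB; rewrite !nb_closed // inE xB.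
have exE : excess e U = excess e (U :\: B).
  rewrite /excess (big_setID B) /= big1 => [|x]; last first.
    by rewrite inE => /andP[_ xB]; have [->] := Bd x xB.
  by rewrite add0n; apply: eq_bigr => x; rewrite inE => /andP[xB xU]; rewrite /dg nbE.
exists A, c.+1; split=> //; first by lia.
exists (v |: X); last by rewrite exE cardsU1; case: (v \in X); lia.
move=> C cC; have [C0 /subsetP CU Cd] := cC.
have [CB|/set0Pn[x]] := eqVneq (C :&: B) set0.
  have nCB x : x \in C -> x \notin B.
    by move=> xC; apply/negP => xB; have := in_set0 x; rewrite -CB inE xC xB.
  have [|x xC xX] := hX C; last by exists x; rewrite // !inE xX orbT.
  split=> // [|x xC]; first by apply/subsetP => x xC; rewrite inE nCB ?CU.
  by rewrite /dg nbE ?nCB ?CU //; apply: Cd.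
rewrite inE => /andP[xC xB]; exists v; last by rewrite !inE eqxx.
suff CB : C :&: B = B by move: vB; rewrite -CB inE => /andP[].
apply: minB; last exact: subsetIr.
split; [by apply/set0Pn; exists x; rewrite inE xC|by apply/subsetP => y; rewrite inE => /andP[/CU]|].
move=> y; rewrite inE => /andP[yC yB]; have [dy ny] := Cd y yC; split=> //.
by rewrite subsetI ny; have [] := Bd y yB.
Qed.

(** Minimum degree 2 makes the truncated subtraction in [excess] exact. *)
Lemma excess_edges A : (forall v, 2 <= deg e v) -> adj_closed A ->
  excess e A + 2 * #|A| = 2 * induced_edges e A.
Proof.
move=> d2 cA; rewrite -handshake mulnC -sum_nat_const -big_split /=.
apply: eq_bigr => x xA; rewrite subnK // /dg nb_closed //; apply: leq_trans (d2 x) _.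
by apply: subset_leq_card; apply/subsetP => y; rewrite !inE.
Qed.

Lemma colorable_SE k L : 0 < k -> colorable e k L setT ->
  exists f, L_coloring e L f /\ SE_coloring k f.
Proof.
move=> k0 [f [fL fe fSE]]; exists f; split.
  by split=> [v|u v uv]; [apply: fL | apply: fe].
move=> n0; have := cardsT T; move: n0; move: #|T| => n n0 cT.
have clsE c : cls f setT c = color_class f c by apply/setP => v; rewrite !inE.
(* Dividing n - 1 instead of n turns the remainder range into 1..k and the quotient plus one into
   the ceiling. *)
have qE : ceil_div n k = ((n - 1) %/ k).+1.
  by rewrite /ceil_div addnC -addnBA // -[X in X + _]mul1n divnMDl.
have mE : modstar n k = ((n - 1) %% k).+1.
  by rewrite /modstar addnC -addnBA // modnDl.
have [||c1 c2] := fSE ((n - 1) %/ k) ((n - 1) %% k).+1.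
- by rewrite ltn_pmod.
- by rewrite cT addnS mulnC -divn_eq subn1 prednK.
rewrite qE mE; split=> [c|]; first by rewrite -clsE.
rewrite -size_filter; apply: c2; first by rewrite filter_uniq ?undup_uniq.
by move=> c; rewrite mem_filter -clsE => /andP[/eqP].
Qed.
End Sparse.

Theorem theorem1p3 (T : finType) (e : rel T) :
  simple_graph e ->
  (forall v : T, 2 <= deg e v) ->
  ((forall A : {set T}, A != set0 -> 6 * induced_edges e A <= 7 * #|A| + 2) ->
     SE_choosable e 3) /\
  ((forall A : {set T}, A != set0 -> 4 * induced_edges e A <= 5 * #|A| + 2) ->
     SE_choosable e 4).
Proof.
move=> [sym irr] d2; have cT : adj_closed e setT by move=> x _ y; rewrite inE.
have [A [c [cA cAT WT]]] := Wle_core sym irr cT; have exA := excess_edges sym irr d2 cA.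
have ex0 : A = set0 -> excess e A = 0 by move=> ->; rewrite /excess big_set0.
split=> sparse L kL; apply: colorable_SE => //.
  have deg2 : degenerate2 e.
    by apply: degenerate2_sparse => // B /sparse; lia.
  apply: (colorable3 sym irr deg2 kL WT).
  (* By [exA], sparsity reads [3 * excess e A <= #|A| + 2], and each of the [c] peeled cycles
     brought three vertices. Sparsity covers only nonempty [A]. *)
  have [/ex0->|/sparse] := eqVneq A set0; lia.
have deg2 : degenerate2 e.
  by apply: degenerate2_sparse => // B /sparse; lia.
apply: (colorable4 sym irr deg2 kL WT).
have [T0|T0] := posnP #|[set: T]|.
  have A0 : A = set0 by apply/eqP; rewrite -cards_eq0; lia.
  by rewrite ex0 //; lia.
have [q [m [m4 nE]]] : exists q m, 0 < m <= 4 /\ #|[set: T]| = 4 * q + m.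
  exists (#|[set: T]|.-1 %/ 4), (#|[set: T]|.-1 %% 4).+1; rewrite ltn_pmod //.
  by split=> //; have := divn_eq #|[set: T]|.-1 4; lia.
move: cAT; rewrite nE bound4E // => cAT.
(* Parity is essential: by [exA] the excess is even. For n = 4q + 4 and c = 0,
   [2 * excess e A <= #|A| + 2] alone would allow 2q + 3, one above [bound4]. *)
have [/ex0->|/sparse] := eqVneq A set0; lia.
Qed.
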